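(* Let $T$ be any additive standard tableau of rectangular shape $a\times b$. For any partition $\lambda$ of length at most $ab$, the triple $(\lambda,a_T(\lambda),b_T(\lambda))$ is stable.
   Context: Kronecker coefficients: $g(\lambda,\mu,\nu)=\dim([\lambda]\otimes[\mu]\otimes[\nu])^{S_n}$ for partitions of $n$, with $[\lambda]$ the irreducible complex $S_n$-representation indexed by $\lambda$; $g=0$ if the sizes differ. Partitions are added componentwise. A triple of partitions $(\alpha,\beta,\gamma)$ is stable if $g(\alpha,\beta,\gamma)\ne0$ and for any triple of partitions $(\lambda,\mu,\nu)$ the sequence $g(\lambda+k\alpha,\mu+k\beta,\nu+k\gamma)$, $k\ge0$, is bounded (or equivalently, eventually constant). A standard tableau $T$ of shape $a\times b$ is a bijective filling of the boxes $(i,j)$, $1\le i\le a$, $1\le j\le b$, by $1,\dots,ab$, with entries $T(i,j)$ increasing along rows and columns. It is additive if there exist increasing sequences $x_1<\cdots<x_a$ and $y_1<\cdots<y_b$ such that $T(i,j)<T(k,l)\Leftrightarrow x_i+y_j<x_k+y_l$. One puts $a_T(\lambda)_i=\sum_{j=1}^b\lambda_{T(i,j)}$ and $b_T(\lambda)_j=\sum_{i=1}^a\lambda_{T(i,j)}$. *)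

(* Defs.v *)
From mathcomp Require Import all_boot all_order all_fingroup all_algebra.
From mathcomp Require Import mxrepresentation character.
From mathcomp Require Export complex reals.

Set Implicit Arguments.
Unset Strict Implicit.
Unset Printing Implicit Defensive.

Import GRing.Theory.
Local Open Scope nat_scope.

(* Partitions are kept in normal form: weakly decreasing, no zero part.  Thus
   [sumn s] is the size of the partition and [size s] is its length. *)
Definition is_partition (s : seq nat) : bool := sorted geq s && (0 \notin s).

(* On a weakly decreasing sequence this only removes trailing zeros. *)
Definition trim (s : seq nat) : seq nat := [seq m <- s | m != 0].

Definition addp (s t : seq nat) : seq nat :=
  mkseq (fun i => nth 0 s i + nth 0 t i) (maxn (size s) (size t)).

(* The case k = 0 gives the empty partition. *)
Definition scalep (k : nat) (s : seq nat) : seq nat := trim [seq k * m | m <- s].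

Section Specht.

Variables (C : fieldType) (n : nat) (lam : seq nat).

(* The boxes of the diagram of lam are numbered by 'I_n row by row (this is
   meaningful when sumn lam = n): the box numbered i lies in row
   [reshape_index lam i] and column [reshape_offset lam i]. *)
Definition row_stab : {set 'S_n} :=
  [set s : 'S_n | [forall i, reshape_index lam (s i) == reshape_index lam i]].

Definition col_stab : {set 'S_n} :=
  [set s : 'S_n | [forall i, reshape_offset lam (s i) == reshape_offset lam i]].

(* The Young symmetrizer (\sum_(p in row_stab) p) (\sum_(q in col_stab) sgn(q) q)
   of the group algebra C[S_n], as an operator of the regular representation. *)
Definition young_symmetrizer :=
  (gset_mx C [set: 'S_n]%G row_stab *m
   \sum_(q in col_stab) ((-1) ^+ odd_perm q *: regular_repr C [set: 'S_n]%G q))%R.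

(* [lam]: the Specht module, realised as the right ideal of C[S_n] generated by
   the Young symmetrizer (mathcomp representations act on row vectors, on the
   right).  It is the irreducible representation indexed by lam, the partition
   (n) giving the trivial representation. *)
Definition specht_repr :=
  submod_repr (cyclic_mx_module (regular_repr C [set: 'S_n]%G)
                 (gring_row young_symmetrizer)).

End Specht.

Definition kronecker (C : fieldType) (lam mu nu : seq nat) : nat :=
  let n := sumn lam in
  if (sumn mu == n) && (sumn nu == n) then
    \rank (rfix_mx (prod_repr (prod_repr (specht_repr C n lam) (specht_repr C n mu))
                              (specht_repr C n nu))
                   [set: 'S_n])
  else 0.

Definition stable (C : fieldType) (alp bet gam : seq nat) : Prop :=
  [/\ [&& is_partition alp, is_partition bet & is_partition gam],
      kronecker C alp bet gam <> 0 &
      forall lam mu nu : seq nat,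
        is_partition lam -> is_partition mu -> is_partition nu ->
        exists N : nat, forall k : nat,
          kronecker C (addp lam (scalep k alp)) (addp mu (scalep k bet))
                      (addp nu (scalep k gam)) <= N].

Section Tableaux.

Variables (a b : nat).

(* Rows, columns and entries are numbered from 0, so the entries of a tableau
   of shape a x b are 0, ..., a * b - 1, and the entry t selects the part
   [nth 0 lam t], i.e. the (t+1)-st part of lam. *)
Implicit Types (T : 'I_a * 'I_b -> 'I_(a * b)) (lam : seq nat).

Definition standard_tableau T : Prop :=
  [/\ bijective T,
      forall (i : 'I_a) (j l : 'I_b), j < l -> T (i, j) < T (i, l) &
      forall (i k : 'I_a) (j : 'I_b), i < k -> T (i, j) < T (k, j)].

Definition additive_tableau (R : realType) T : Prop :=
  exists (x : 'I_a -> R) (y : 'I_b -> R),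
    [/\ forall i k : 'I_a, i < k -> (x i < x k)%R,
        forall j l : 'I_b, j < l -> (y j < y l)%R &
        forall (i k : 'I_a) (j l : 'I_b),
          T (i, j) < T (k, l) <-> (x i + y j < x k + y l)%R].

Definition aT T lam : seq nat :=
  trim [seq \sum_(j < b) nth 0 lam (T (i, j)) | i <- enum 'I_a].

Definition bT T lam : seq nat :=
  trim [seq \sum_(i < a) nth 0 lam (T (i, j)) | j <- enum 'I_b].

End Tableaux.

(* Main.v *)
Require Import Defs.
From mathcomp Require Import all_boot all_order all_fingroup all_algebra.
From mathcomp Require Import mxrepresentation character lra.

(** Write S(s) for the right ideal of C[S_n] generated by the Young symmetrizer
    e_s = sum_(p in rows, q in columns) sgn(q) p q
of the partition s.  The Kronecker coefficient is the dimension of the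
invariants of S(lam) (x) S(mu) (x) S(nu); these are spanned by the tensors
    inv(u, v, w) = sum_g u g (x) v g (x) w g,
and both halves of the theorem come from a good choice of u, v and w.

Upper bound.  S(mu) is generated by e_mu, but also by w_mu = sum_(p in rows)
e_mu p ([tabloid_vector_cyclic]): e e^* = |columns| w for e = e_mu, and a real
matrix M has the same row space as its Gram matrix M^T M.  Since w_mu is fixed
by the row group, the invariants are spanned by the tensors
inv(e_lam, w_mu g, w_nu h), and such a tensor depends only on the labelling of
the boxes of lam by pairs (row of mu, row of nu) that g and h induce.
The sign rule for e_lam kills the labellings that repeat a label in a column of
lam, and makes the others depend, up to sign, only on the multiset of the sets
of labels of the columns ([bad_class_perm], [specht_vector_colperm]).  So the
Kronecker coefficient is at most the number of these multisets.

Additivity then bounds this number.  Let w(i, j) = x_i + y_j be the weights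
that define the order of T, made positive, and made very large outside the
a x b rectangle.  The total weight of a labelling is determined by its marginals
mu and nu.  Among the sets of l labels, the lightest is the set P_l of the first
l boxes of T, and every other set is heavier by a fixed eps > 0 ([weight_gap]);
for l > ab, where P_l is the whole rectangle, every set of l labels is heavier
by eps.  For the triple
(lam0 + k lam, mu0 + k a_T(lam), nu0 + k b_T(lam)) the part of the weight that
is linear in k is exactly absorbed by the columns P_l, so the number of columns
different from P_l is bounded independently of k, and so is the number of
multisets ([kronecker_bounded]).

Non-vanishing.  Stack the boxes of lam as a three-dimensional diagram: the box
in row T(i, j) and column c of lam sits at (i, j, c).  As T is standard, the
lines in the directions i and j are initial segments, so the diagram is also a tableau of
shape a_T(lam) with rows i and columns (j, c), and similarly one of shape
b_T(lam) with rows j and columns (i, c) ([filling_perm_exists]).  With the three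
Young symmetrizers of these tableaux, a coordinate of inv is
    sum_g e_1(g) e_2(g) e_3(g),
which up to a positive factor is the coefficient of 1 in A B A B, where A is the
sum of the group that preserves all (i, c) and B the signed sum of the
group that preserves all (j, c).  That coefficient is, up to a positive factor,
the squared norm of A B A, whose coefficient at 1 is not zero
([signed_count_gt0], [sum_young_coef3]). *)

Set Implicit Arguments.
Unset Strict Implicit.
Unset Printing Implicit Defensive.

Import Order.TTheory GRing.Theory Num.Theory.
Local Open Scope ring_scope.

(** * Pure tensors and the invariants of a triple tensor product *)

Section Tensor.
Variable F : fieldType.

Lemma tprod_row n1 n2 (u : 'rV[F]_n1) (v : 'rV[F]_n2) : tprod u v = trow u v.
Proof.
rewrite /= /col_mx; apply/matrixP=> i j; rewrite !mxE.
case: splitP => [k _|[]//]; rewrite !ord1.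
have -> : usubmx (u : 'M_(1 + 0, n1)) = u.
  by apply/rowP => i'; rewrite !mxE; congr (u _ _); apply: val_inj.
by [].
Qed.

Lemma trowM n1 n2 p1 p2 (u : 'rV[F]_n1) (v : 'rV[F]_n2)
    (A : 'M_(n1, p1)) (B : 'M_(n2, p2)) :
  trow u v *m tprod A B = trow (u *m A) (v *m B).
Proof. by have := tprodE u A v B; rewrite !tprod_row => ->. Qed.

Lemma row_trow n1 m2 n2 (u : 'rV[F]_n1) (V : 'M_(m2, n2)) t :
  row t (trow u V) = trow u (row t V).
Proof.
elim: n1 u => [|n1 IH] u /=; first by apply/matrixP => i [].
rewrite -IH; apply/matrixP => i j; rewrite !mxE.
by case: split => k; rewrite !mxE.
Qed.

(** Linear maps out of a tensor product are controlled by pure tensors: a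
spanning set of a tensor product may be tested one pair of rows at a time. *)
Lemma tprod_sub m1 n1 m2 n2 k p (U : 'M[F]_(m1, n1)) (V : 'M[F]_(m2, n2))
    (Q : 'M_(n1 * n2, k)) (W : 'M_(p, k)) :
  (forall s t, (trow (row s U) (row t V) *m Q <= W)%MS) ->
  (tprod U V *m Q <= W)%MS.
Proof.
elim: m1 U => [|m1 IH] U UVW /=; first by rewrite mul0mx sub0mx.
rewrite mul_col_mx col_mx_sub; apply/andP; split.
  apply/row_subP => t; rewrite row_mul row_trow.
  suff -> : usubmx (U : 'M_(1 + m1, _)) = row 0 U by exact: UVW.
  by apply/matrixP => i j; rewrite !mxE ord1; congr (U _ _); apply: val_inj.
apply: IH => s t.
suff -> : row s (dsubmx (U : 'M_(1 + m1, _))) = row (rshift 1 s) U by exact: UVW.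
by apply/matrixP => i j; rewrite !mxE.
Qed.

Lemma tprod_full m1 n1 m2 n2 (U : 'M[F]_(m1, n1)) (V : 'M[F]_(m2, n2)) :
  row_full U -> row_full V -> row_full (tprod U V).
Proof.
move=> /row_fullP[U' UU] /row_fullP[V' VV]; apply/row_fullP.
by exists (tprod U' V'); rewrite -tprodE UU VV tprod1.
Qed.

Lemma trowZl c n1 m2 n2 (u : 'rV[F]_n1) (V : 'M_(m2, n2)) :
  trow (c *: u) V = c *: trow u V.
Proof. by rewrite -trowbE linearZ. Qed.

Lemma trow_entry (u v : 'rV[F]_1) i j : trow u v i j = u 0 0 * v 0 0.
Proof.
rewrite /= !mxE; case: splitP => [k _|[]//].
by rewrite !mxE !ord1.
Qed.

End Tensor.

Section Invariants.

Variables (F : fieldType) (gT : finGroupType) (G : {group gT}).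
Variables (d1 d2 d3 : nat) (r1 : mx_representation F G d1)
  (r2 : mx_representation F G d2) (r3 : mx_representation F G d3).

(** The orbit sum of a pure tensor, which is |G| times its projection to the
invariants. *)
Definition invariant_tensor u v w : 'rV[F]_(d1 * d2 * d3) :=
  \sum_(g in G) trow (trow (u *m r1 g) (v *m r2 g)) (w *m r3 g).

Local Notation rG := (prod_repr (prod_repr r1 r2) r3).

Lemma invariant_tensorJ u v w h : h \in G ->
  invariant_tensor (u *m r1 h) (v *m r2 h) (w *m r3 h) = invariant_tensor u v w.
Proof.
move=> Gh; rewrite /invariant_tensor [RHS](reindex_inj (mulgI h)) /=.
by apply: eq_big => g; rewrite ?groupMl // => Gg; rewrite -!mulmxA -!repr_mxM.
Qed.

Lemma invariant_tensor_sum u v w :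
  invariant_tensor u v w = trow (trow u v) w *m (\sum_(g in G) rG g).
Proof.
by rewrite mulmx_sumr; apply: eq_bigr => g _; rewrite /= !trowM.
Qed.

Lemma invariant_tensor_fix u v w : (invariant_tensor u v w <= rfix_mx rG G)%MS.
Proof.
apply/rfix_mxP => h Gh; rewrite -[RHS](invariant_tensorJ u v w Gh).
rewrite invariant_tensorJ // /invariant_tensor [RHS](reindex_inj (mulIg h)) mulmx_suml.
apply: eq_big => g; rewrite ?groupMr // => Gg.
by rewrite /= !trowM -!mulmxA -!repr_mxM.
Qed.

Lemma invariant_tensorZ c u v w :
  invariant_tensor (c *: u) v w = c *: invariant_tensor u v w.
Proof.
rewrite /invariant_tensor scaler_sumr; apply: eq_bigr => g _.
by rewrite -scalemxAl !trowZl.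
Qed.

Lemma rfix_mx_sub_tensor : #|G|%:R != 0 :> F ->
  (rfix_mx rG G <= (\sum_(g in G) rG g)%R)%MS.
Proof.
move=> nzG; apply/submxP; exists (#|G|%:R^-1 *: rfix_mx rG G).
rewrite -scalemxAl mulmx_sumr (eq_bigr (fun=> rfix_mx rG G)).
  by rewrite sumr_const -scaler_nat scalerA mulVf ?scale1r.
by move=> g Gg; apply: rfix_mx_id.
Qed.

Variables (v1 : 'rV[F]_d1) (v2 : 'rV[F]_d2) (v3 : 'rV[F]_d3).

(** By [invariant_tensorJ] the translation of the first factor can be undone, so
these tensors suffice to span the invariants when [v1], [v2] and [v3] generate
their modules. *)
Definition orbit_tensor (g : gT * gT) :=
  invariant_tensor v1 (v2 *m r2 g.1) (v3 *m r3 g.2).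

Let orbit_mx d (r : mx_representation F G d) v :=
  \matrix_(i < #|G|) (v *m r (enum_val i)).

Let orbit_full d (r : mx_representation F G d) v :
  (1%:M <= cyclic_mx r v)%MS -> row_full (orbit_mx r v).
Proof.
rewrite -sub1mx => /submx_trans; apply; apply: cyclic_mx_sub.
  apply/mxmoduleP => x Gx; apply/row_subP => i; rewrite row_mul rowK -mulmxA.
  rewrite -repr_mxM ?enum_valP //.
  have Gix : (enum_val i * x)%g \in G by rewrite groupM ?enum_valP.
  rewrite -(gring_indexK _ Gix) -(rowK (fun i => v *m r (enum_val i))).
  exact: row_sub.
rewrite -[X in (X <= _)%MS](mulmx1 v) -(repr_mx1 r) -(gring_indexK _ (group1 G)).
rewrite -(rowK (fun i => v *m r (enum_val i))); exact: row_sub.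
Qed.

(** The averaging operator maps a spanning set onto a spanning set of the
invariants, and each class of [kappa] contributes at most one line. *)
Lemma rank_rfix_classes (I : finType) (kappa : gT * gT -> I) :
    #|G|%:R != 0 :> F ->
    (1%:M <= cyclic_mx r1 v1)%MS -> (1%:M <= cyclic_mx r2 v2)%MS ->
    (1%:M <= cyclic_mx r3 v3)%MS ->
    (forall g h, g.1 \in G -> g.2 \in G -> h.1 \in G -> h.2 \in G ->
      orbit_tensor g != 0 -> orbit_tensor h != 0 -> kappa g = kappa h ->
      (orbit_tensor g <= orbit_tensor h)%MS) ->
  (\rank (rfix_mx rG G) <= #|I|)%N.
Proof.
move=> nzG c1 c2 c3 eqPhi.
pose good i (g : gT * gT) :=
  [&& g.1 \in G, g.2 \in G, orbit_tensor g != 0 & kappa g == i].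
pose W := \matrix_(i < #|I|)
   if [pick g | good (enum_val i) g] is Some g then orbit_tensor g else 0.
have subW g : g.1 \in G -> g.2 \in G -> (orbit_tensor g <= W)%MS.
  move=> Gg1 Gg2; have [->|nzg] := eqVneq (orbit_tensor g) 0; first exact: sub0mx.
  apply: submx_trans (row_sub (enum_rank (kappa g)) W); rewrite rowK enum_rankK.
  case: pickP => [h /and4P[Gh1 Gh2 nzh /eqP kh] | /(_ g)]; last first.
    by rewrite /good Gg1 Gg2 nzg eqxx.
  by apply: eqPhi.
suff sW : (rfix_mx rG G <= W)%MS by apply: leq_trans (mxrankS sW) (rank_leq_row W).
apply: submx_trans (rfix_mx_sub_tensor nzG) _.
set P := \sum_(g in G) _.
have full := tprod_full (tprod_full (orbit_full c1) (orbit_full c2)) (orbit_full c3).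
suff sub: (tprod (tprod (orbit_mx r1 v1) (orbit_mx r2 v2)) (orbit_mx r3 v3) *m P <= W)%MS.
  case/row_fullP: full => B B1.
  by rewrite -[P]mul1mx -B1 -mulmxA; apply: submx_trans (submxMl _ _) sub.
apply: tprod_sub => s t; set w := row t _.
rewrite -trowbE -(mul_rV_lin1 (trowb w)) -mulmxA -row_mul.
apply: submx_trans (row_sub _ _) _.
apply: tprod_sub => {}s i.
rewrite mulmxA mul_rV_lin1 /= -invariant_tensor_sum.
rewrite {}/w !rowK; set a := enum_val s; set b := enum_val i; set c := enum_val t.
have [Ga Gb Gc] : [/\ a \in G, b \in G & c \in G] by split; apply: enum_valP.
(* Translating by a^-1 brings the first factor back to v1. *)
have -> : invariant_tensor (v1 *m r1 a) (v2 *m r2 b) (v3 *m r3 c)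
        = orbit_tensor (b * a^-1, c * a^-1)%g.
  rewrite -(invariant_tensorJ _ _ _ (groupVr Ga)) /orbit_tensor /=.
  by rewrite -!mulmxA -!repr_mxM ?groupV // mulgV repr_mx1 mulmx1.
by apply: subW; rewrite /= groupM ?groupV.
Qed.

(** The sum is the value on the invariant tensor of the product of three linear
forms, so the tensor is not zero. *)
Lemma invariant_tensor_coord (f1 : 'cV_d1) (f2 : 'cV_d2) (f3 : 'cV_d3)
    (u : 'rV_d1) (v : 'rV_d2) (w : 'rV_d3) :
    \sum_(g in G) (u *m r1 g *m f1) 0 0 * (v *m r2 g *m f2) 0 0 *
                  (w *m r3 g *m f3) 0 0 != 0 ->
  \rank (rfix_mx rG G) != 0%N.
Proof.
apply: contraNneq => /eqP; rewrite mxrank_eq0 => /eqP fix0.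
have := invariant_tensor_fix u v w; rewrite fix0 submx0 => /eqP t0.
have := congr1 (fun t => (t *m tprod (tprod f1 f2) f3) 0 0) t0.
rewrite mul0mx [RHS]mxE /invariant_tensor mulmx_suml summxE => E; apply/eqP; rewrite -[RHS]E.
by apply: eq_bigr => g _; rewrite !trowM !trow_entry.
Qed.

End Invariants.

(** * Stabilisers of functions, and real vectors in the regular representation *)

Section FunStab.
Variables (n : nat) (K : eqType) (f : 'I_n -> K).

Definition fun_stab : {set 'S_n} := [set s : 'S_n | [forall i, f (s i) == f i]].

Lemma fun_stabP (s : 'S_n) : reflect (forall i, f (s i) = f i) (s \in fun_stab).
Proof. by rewrite inE; apply: (iffP forallP) => fs i; apply/eqP. Qed.

Lemma fun_stab_group_set : group_set fun_stab.
Proof.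
apply/group_setP; split=> [|s t /fun_stabP fs /fun_stabP ft]; apply/fun_stabP => i.
  by rewrite perm1.
by rewrite permM ft fs.
Qed.

Canonical fun_stab_group := Group fun_stab_group_set.
End FunStab.

Section Gram.
Variable C : numClosedFieldType.

(** If v M^T M = 0 then the vector v M^T has squared norm v M^T M v^* = 0, so M
and M^T M have the same rank. *)
Lemma real_row_gram m n (M : 'M[C]_(m, n)) :
  map_mx Num.conj M = M -> (M <= M^T *m M)%MS.
Proof.
move=> reM; rewrite -(mxrank_leqif_sup (submxMl M^T M)).
apply/eqP/eqP; rewrite eqn_leq mxrankM_maxr -{1}mxrank_tr.
have kerM : (kermx (M^T *m M) <= kermx M^T)%MS.
  apply/rV_subP => v /sub_kermxP vMM; apply/sub_kermxP.
  pose y := v *m M^T.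
  have yy0 : \sum_i y 0 i * (y 0 i)^* = 0.
    have E : (y *m (map_mx Num.conj y)^T) 0 0 = 0.
      rewrite /y map_mxM -map_trmx reM trmx_mul trmxK !mulmxA -(mulmxA v) vMM.
      by rewrite mul0mx mxE.
    by rewrite -[RHS]E mxE; apply: eq_bigr => i _; congr (_ * _); rewrite [RHS]mxE [RHS]mxE.
  apply/rowP => i; rewrite [RHS]mxE; apply/eqP.
  by rewrite -mul_conjC_eq0 (psumr_eq0P _ yy0) // => j _; apply: mul_conjC_ge0.
have := mxrankS kerM; rewrite !mxrank_ker leq_sub2lE //.
exact: rank_leq_row.
Qed.
End Gram.

Section Regular.
Variables (F : fieldType) (gT : finGroupType) (G : {group gT}).
Local Notation aG := (regular_repr F G).

Definition regular_basis (g : gT) : 'rV[F]_#|G| := delta_mx 0 (gring_index G g).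
Local Notation e_ := regular_basis.

Lemma regular_basisJ g h : g \in G -> h \in G -> e_ g *m aG h = e_ (g * h)%g.
Proof. by move=> Gg Gh; rewrite -rowE rowK gring_indexK. Qed.

Lemma regular_basis_coord g h : g \in G -> h \in G ->
  (e_ g *m (e_ h)^T) 0 0 = (g == h)%:R.
Proof.
move=> Gg Gh; rewrite trmx_delta mul_delta_mx_cond.
rewrite (inj_in_eq (can_in_inj (@gring_indexK _ G))) //.
by case: eqP; rewrite !mxE ?eqxx.
Qed.

Lemma regular_coordJ (u : 'rV_#|G|) g h : g \in G -> h \in G ->
  (u *m aG g) 0 (gring_index G h) = u 0 (gring_index G (h * g^-1)%g).
Proof.
move=> Gg Gh; rewrite [u in LHS]row_sum_delta mulmx_suml summxE.
rewrite (bigD1 (gring_index G (h * g^-1)%g)) //= big1 ?addr0 => [|i nei].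
  rewrite -scalemxAl regular_basisJ ?groupM ?groupV // mulgKV.
  by rewrite !mxE !eqxx mulr1.
rewrite -scalemxAl -(gring_valK i) regular_basisJ ?enum_valP // !mxE eqxx /=.
case: eqP => [ih|]; last by rewrite mulr0.
case/negP: nei; apply/eqP; rewrite -[LHS](gring_valK i); congr gring_index.
apply: (mulIg g); rewrite mulgKV.
by rewrite -[h](gring_indexK _ Gh) ih gring_indexK ?groupM ?enum_valP.
Qed.
End Regular.

(** For u = sum_x u_x x the generator on the right is u u^*, with
u^* = sum_x u_x x^-1.  If M is the matrix whose rows are the translates of u,
the row h of M^T M is the translate of u u^* by h. *)
Lemma cyclic_gram (C : numClosedFieldType) (gT : finGroupType) (G : {group gT})
    (u : 'rV[C]_#|G|) : map_mx Num.conj u = u ->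
  (u <= cyclic_mx (regular_repr C G)
    (\sum_(x in G) u 0 (gring_index G x) *: (u *m regular_repr C G x^-1%g)))%MS.
Proof.
move=> reu; set aG := regular_repr C G; set w := \sum_(x in G) _.
pose M := \matrix_(i < #|G|) (u *m aG (enum_val i)).
have reM : map_mx Num.conj M = M.
  apply/row_matrixP => i; rewrite -map_row rowK map_mxM reu; congr (_ *m _).
  apply/matrixP => j k; rewrite !mxE.
  by case: (_ == _); case: (_ == _); rewrite ?rmorph1 ?rmorph0.
have uM : (u <= M)%MS.
  rewrite -[X in (X <= _)%MS]mulmx1 -(repr_mx1 aG) -(gring_indexK _ (group1 G)).
  by rewrite -(rowK (fun i => u *m aG (enum_val i))) row_sub.
apply: submx_trans (submx_trans uM (real_row_gram reM)) _.
apply/row_subP => k; rewrite row_mul mulmx_sum_row.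
suff -> : \sum_i (row k M^T) 0 i *: row i M = w *m aG (enum_val k).
  by rewrite mxmodule_trans ?cyclic_mx_module ?cyclic_mx_id ?enum_valP.
set h := enum_val k; have Gh : h \in G by apply: enum_valP.
transitivity (\sum_(g in G) (u *m aG g) 0 (gring_index G h) *: (u *m aG g)).
  rewrite [RHS]big_enum_val; apply: eq_bigr => i _.
  by rewrite rowK /h gring_valK !mxE.
(* The change of variables g = x^-1 h identifies the row h of M^T M with the translate of w by h. *)
have injh : injective (fun x : gT => x^-1 * h)%g.
  by move=> x y /mulIg /invg_inj.
rewrite (reindex_inj injh) mulmx_suml /=.
apply: eq_big => x; first by rewrite groupMr // groupV.
rewrite groupMr // groupV => Gx.
rewrite regular_coordJ ?groupM ?groupV // invMg invgK mulKVg.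
by rewrite -scalemxAl -mulmxA -repr_mxM ?groupV.
Qed.

(** * Two generators of a Specht module *)

Section SpechtVectors.

Variables (C : numClosedFieldType) (n : nat) (s : seq nat).

Local Notation Sn := [set: 'S_n].
Local Notation aG := (regular_repr C [set: 'S_n]%G).
Local Notation e_ := (@regular_basis C _ [set: 'S_n]%G).
Local Notation sg q := ((-1) ^+ odd_perm q : C).
Local Notation Rs := (row_stab n s).
Local Notation Cs := (col_stab n s).
Local Notation rS := (specht_repr C n s).

Definition young_vector : 'rV[C]_#|[set: 'S_n]| :=
  gring_row (young_symmetrizer C n s).

Definition row_group := [group of fun_stab (fun i : 'I_n => reshape_index s i)].
Definition col_group := [group of fun_stab (fun i : 'I_n => reshape_offset s i)].

Lemma row_stabE : Rs = row_group. Proof. by []. Qed.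
Lemma col_stabE : Cs = col_group. Proof. by []. Qed.

Lemma young_vectorE :
  young_vector = \sum_(p in Rs) \sum_(q in Cs) sg q *: e_ (p * q)%g.
Proof.
rewrite /young_vector /young_symmetrizer gring_row_mul /gset_mx.
rewrite [gring_row _]linear_sum mulmx_suml; apply: eq_bigr => p _.
rewrite mulmx_sumr; apply: eq_bigr => q _.
rewrite -scalemxAr; congr (_ *: _).
rewrite -regular_basisJ ?inE //; congr (_ *m _).
by rewrite /= /gring_row rowE -/(e_ 1%g) regular_basisJ ?inE // mul1g.
Qed.

Lemma young_vectorJ g :
  young_vector *m aG g = \sum_(p in Rs) \sum_(q in Cs) sg q *: e_ (p * q * g)%g.
Proof.
rewrite young_vectorE mulmx_suml; apply: eq_bigr => p _.
rewrite mulmx_suml; apply: eq_bigr => q _.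
by rewrite -scalemxAl regular_basisJ ?inE.
Qed.

Lemma young_vector_col q : q \in Cs -> young_vector *m aG q = sg q *: young_vector.
Proof.
rewrite col_stabE => Cq; rewrite young_vectorJ young_vectorE scaler_sumr.
apply: eq_bigr => p _; rewrite scaler_sumr [RHS](reindex_inj (mulIg q)).
apply: eq_big => x; rewrite !col_stabE ?groupMr // => Cx.
by rewrite mulgA scalerA odd_permM signr_addb mulrCA -signr_addb addbb mulr1.
Qed.

(** [t] can be moved to the left through the signed column sum, and is then
absorbed by the row sum. *)
Lemma young_vector_norm t : t \in Rs -> t \in 'N(Cs)%g -> young_vector *m aG t = young_vector.
Proof.
rewrite row_stabE => Rt Nt; rewrite young_vectorJ young_vectorE.
rewrite [RHS](reindex_inj (mulIg t)).
apply: eq_big => p; rewrite !row_stabE ?groupMr // => Rp.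
rewrite [RHS](reindex_inj (conjg_inj t)).
apply: eq_big => q; first by rewrite memJ_norm.
by move=> Cq; rewrite odd_permJ conjgE !mulgA mulgK.
Qed.

Lemma young_vector_real : map_mx Num.conj young_vector = young_vector.
Proof.
rewrite young_vectorE; apply/rowP => i; rewrite mxE !summxE rmorph_sum.
apply: eq_bigr => p _; rewrite !summxE rmorph_sum.
apply: eq_bigr => q _; rewrite !mxE rmorphM rmorph_sign.
by case: (_ && _); rewrite ?rmorph1 ?rmorph0.
Qed.

(** The Young symmetrizer, in the coordinates of the submodule that it generates. *)
Definition specht_vector : 'rV[C]_(\rank (cyclic_mx aG young_vector)) :=
  in_submod _ young_vector.

Lemma val_specht_vector : val_submod specht_vector = young_vector.
Proof. by rewrite in_submodK ?cyclic_mx_id. Qed.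

Lemma val_specht_vectorJ g :
  val_submod (specht_vector *m rS g) = young_vector *m aG g.
Proof. by rewrite val_submodJ ?inE // val_specht_vector. Qed.

Lemma specht_vector_col q : q \in Cs -> specht_vector *m rS q = sg q *: specht_vector.
Proof.
move=> Cq; apply: val_submod_inj.
by rewrite linearZ /= val_specht_vectorJ young_vector_col // val_specht_vector.
Qed.

Lemma specht_vector_norm t :
  t \in Rs -> t \in 'N(Cs)%g -> specht_vector *m rS t = specht_vector.
Proof.
move=> Rt Nt; apply: val_submod_inj.
by rewrite val_specht_vectorJ young_vector_norm // val_specht_vector.
Qed.

Lemma specht_cyclic (v : 'rV_(\rank (cyclic_mx aG young_vector))) :
    (young_vector <= cyclic_mx aG (val_submod v))%MS ->
  (1%:M <= cyclic_mx rS v)%MS.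
Proof.
move=> yv; rewrite -val_submodS val_submod1.
have mod_v : mxmodule aG (val_submod (cyclic_mx rS v)).
  by rewrite (val_submod_module (cyclic_mx_module aG young_vector)) cyclic_mx_module.
apply: cyclic_mx_sub => //; apply: submx_trans yv _.
by apply: cyclic_mx_sub => //; rewrite val_submodS cyclic_mx_id.
Qed.

Lemma specht_vector_cyclic : (1%:M <= cyclic_mx rS specht_vector)%MS.
Proof. by apply: specht_cyclic; rewrite val_specht_vector cyclic_mx_id. Qed.

(** The image of the Young symmetrizer e = a b under x |-> x a; like a tabloid, it
is fixed by the row group. *)
Definition tabloid_vector := \sum_(p in Rs) specht_vector *m rS p.

Lemma tabloid_vector_row p : p \in Rs -> tabloid_vector *m rS p = tabloid_vector.
Proof.
rewrite row_stabE => Rp; rewrite /tabloid_vector mulmx_suml.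
rewrite [RHS](reindex_inj (mulIg p)).
apply: eq_big => x; rewrite !row_stabE ?groupMr // => Rx.
by rewrite repr_mxM ?inE // [RHS]mulmxA.
Qed.

(** For the Young symmetrizer e = a b, with a the row sum and b the signed column
sum, one has e e^* = a b b a = |columns| (a b a), so that [cyclic_gram] applies. *)
Lemma tabloid_vector_cyclic : (1%:M <= cyclic_mx rS tabloid_vector)%MS.
Proof.
apply: specht_cyclic; apply: submx_trans (cyclic_gram young_vector_real) _.
set w := \sum_(x in _) _.
have -> : w = #|Cs|%:R *: val_submod tabloid_vector.
  (* The linear map y |-> e y^*. *)
  pose psi (y : 'rV[C]_#|Sn|) := \sum_(x in Sn)
    y 0 (gring_index [set: 'S_n]%G x) *: (young_vector *m aG x^-1%g).
  have psi_basis g : psi (e_ g) = young_vector *m aG g^-1%g.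
    rewrite /psi (bigD1 g) ?inE //= big1 ?addr0 => [|x nexg].
      by rewrite !mxE !eqxx scale1r.
    rewrite !mxE eqxx (inj_in_eq (can_in_inj (@gring_indexK _ _))) ?inE //.
    by move: nexg => /andP[_ /negPf->]; rewrite scale0r.
  transitivity (psi young_vector); first by [].
  have psi_sum (I : finType) (P : pred I) (c : I -> C) (g : I -> 'S_n) :
      psi (\sum_(i | P i) c i *: e_ (g i)) = \sum_(i | P i) c i *: psi (e_ (g i)).
    rewrite [LHS]/psi; under eq_bigr => x _ do rewrite summxE scaler_suml.
    rewrite exchange_big /=; apply: eq_bigr => i _; rewrite scaler_sumr.
    by apply: eq_bigr => x _; rewrite mxE scalerA.
  rewrite young_vectorE pair_big psi_sum /= -(pair_big _ _ (fun p q => sg q *: psi (e_ (p * q)%g))).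
  rewrite /tabloid_vector linear_sum scaler_sumr [RHS](reindex_inj invg_inj) /=.
  apply: eq_big => p; first by rewrite row_stabE groupV.
  rewrite row_stabE => Rp; rewrite val_specht_vectorJ scaler_nat -sumr_const.
  apply: eq_bigr => q; rewrite col_stabE => Cq.
  rewrite psi_basis invMg repr_mxM ?inE // mulmxA young_vector_col ?col_stabE ?groupV //.
  by rewrite -scalemxAl scalerA odd_permV -signr_addb addbb scale1r.
apply: cyclic_mx_sub; first exact: cyclic_mx_module.
by rewrite scalemx_sub ?cyclic_mx_id.
Qed.

Lemma young_vector_coord g h :
  (young_vector *m aG g *m (e_ h)^T) 0 0
  = \sum_(p in Rs) \sum_(q in Cs) sg q * (p * q == h * g^-1)%g%:R.
Proof.
rewrite young_vectorJ mulmx_suml summxE; apply: eq_bigr => p _.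
rewrite mulmx_suml summxE; apply: eq_bigr => q _.
rewrite -scalemxAl mxE regular_basis_coord ?inE //.
by rewrite -[h in LHS](mulgKV g) (inj_eq (mulIg g)).
Qed.

End SpechtVectors.

(** * Boxes of a diagram, and permutations that permute its columns *)

Lemma geq_transitive : transitive geq.
Proof. by move=> x y z le1 le2; apply: leq_trans le2 le1. Qed.

Section Boxes.
Local Open Scope nat_scope.

Variables (n : nat) (s : seq nat).
Hypothesis sum_s : sumn s = n.

Local Notation row x := (reshape_index s (nat_of_ord x)).
Local Notation col x := (reshape_offset s (nat_of_ord x)).

Lemma box_row_lt (x : 'I_n) : row x < size s.
Proof. by apply: reshape_indexP; rewrite sum_s. Qed.

Lemma box_col_lt (x : 'I_n) : col x < nth 0 s (row x).
Proof. by apply: reshape_offsetP; rewrite sum_s. Qed.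

Lemma box_inj (x y : 'I_n) : row x = row y -> col x = col y -> x = y.
Proof.
move=> eqr eqc; apply: val_inj.
by rewrite /= -(reshape_indexK s x) eqr eqc reshape_indexK.
Qed.

Definition box_of r c (lt_c : c < nth 0 s r) : 'I_n :=
  Ordinal (eq_ind _ (fun m => flatten_index s r c < m) (flatten_indexP lt_c) _ sum_s).

Lemma row_box_of r c (lt_c : c < nth 0 s r) : row (box_of lt_c) = r.
Proof. exact: flatten_indexKl. Qed.

Lemma col_box_of r c (lt_c : c < nth 0 s r) : col (box_of lt_c) = c.
Proof. exact: flatten_indexKr. Qed.

Lemma box_ex r c : c < nth 0 s r -> exists x : 'I_n, row x = r /\ col x = c.
Proof. by move=> lt_c; exists (box_of lt_c); rewrite row_box_of col_box_of. Qed.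

Lemma card_row r : #|[set x : 'I_n | row x == r]| = nth 0 s r.
Proof.
rewrite -[RHS]card_ord.
have inj : injective (fun c : 'I_(nth 0 s r) => box_of (ltn_ord c)).
  by move=> c d /(congr1 (fun x : 'I_n => col x)); rewrite !col_box_of => /val_inj.
rewrite -(card_imset _ inj); apply: eq_card => x; rewrite inE.
apply/eqP/imsetP => [rx | [c _ ->]]; last exact: row_box_of.
have lt_c : col x < nth 0 s r by rewrite -rx box_col_lt.
exists (Ordinal lt_c) => //; apply: box_inj; first by rewrite row_box_of.
by rewrite col_box_of.
Qed.

Lemma part_leq_sum r : nth 0 s r <= n.
Proof. by rewrite -(card_row r) -[X in _ <= X]card_ord max_card. Qed.

Lemma sum_row (V : nmodType) (F : nat -> V) N : size s <= N ->
  (\sum_(x < n) F (row x) = \sum_(r < N) F r *+ nth 0 s r)%R.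
Proof.
move=> le_sN; have ltN (x : 'I_n) : row x < N by apply: leq_trans (box_row_lt x) _.
rewrite (partition_big (fun x => Ordinal (ltN x)) predT) //=.
apply: eq_bigr => r _; rewrite -(card_row r) -sumr_const.
apply: eq_big => x; first by rewrite inE -val_eqE.
by move=> /eqP <-.
Qed.

Definition col_len c := find (fun m => m <= c) s.

Hypothesis part_s : sorted geq s.

Lemma part_leq i j : i <= j -> nth 0 s j <= nth 0 s i.
Proof.
move=> le_ij; case: (ltnP j (size s)) => [lt_j | ?]; last by rewrite nth_default.
by apply: (sorted_leq_nth geq_transitive leqnn 0 part_s); rewrite ?inE ?(leq_ltn_trans le_ij).
Qed.

Lemma ltn_col_len r c : (r < col_len c) = (c < nth 0 s r).
Proof.
apply/idP/idP => [/(before_find 0)/negbT|]; first by rewrite -ltnNge.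
rewrite ltnNge; apply: contraR; rewrite -leqNgt => le_r.
case: (boolP (has (fun m => m <= c) s)) => [/(nth_find 0) le_c | nohas].
  by apply: leq_trans le_c; apply: part_leq.
by rewrite nth_default // (leq_trans _ le_r) // /col_len hasNfind.
Qed.

Lemma card_col c : #|[set x : 'I_n | col x == c]| = col_len c.
Proof.
rewrite -[RHS]card_ord.
have lt_c (r : 'I_(col_len c)) : c < nth 0 s r by rewrite -ltn_col_len.
have inj : injective (fun r : 'I_(col_len c) => box_of (lt_c r)).
  by move=> r t /(congr1 (fun x : 'I_n => row x)); rewrite !row_box_of => /val_inj.
rewrite -(card_imset _ inj); apply: eq_card => x; rewrite inE.
apply/eqP/imsetP => [cx | [r _ ->]]; last exact: col_box_of.
have lt_r : row x < col_len c by rewrite ltn_col_len -cx box_col_lt.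
exists (Ordinal lt_r) => //; apply: box_inj; first by rewrite row_box_of.
by rewrite col_box_of.
Qed.

End Boxes.

(** Columns of equal length are exchanged by a row permutation that normalises the
column group, and the rest of [rho] permutes each column in itself. *)
Lemma specht_vector_colperm (C : numClosedFieldType) n s (rho : 'S_n) :
    sumn s = n -> sorted geq s ->
    (forall x y : 'I_n, reshape_offset s x = reshape_offset s y <->
                        reshape_offset s (rho x) = reshape_offset s (rho y)) ->
  specht_vector C n s *m specht_repr C n s rho = specht_vector C n s \/
  specht_vector C n s *m specht_repr C n s rho = - specht_vector C n s.
Proof.
move=> sum_s part_s colrho.
have rho_col x y := (colrho x y).2; have {}colrho x y := (colrho x y).1.
have len_rho (x : 'I_n) :
    col_len s (reshape_offset s (rho x)) = col_len s (reshape_offset s x).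
  rewrite -!(card_col sum_s part_s) -[RHS](card_imset _ (@perm_inj _ rho)).
  apply: eq_card => y; rewrite inE; apply/eqP/imsetP => [cy | [z]].
    by exists (rho^-1 y)%g; rewrite ?permKV // inE; apply/eqP/rho_col; rewrite permKV.
  by rewrite inE => /eqP cz ->; apply/colrho.
have lt_t (x : 'I_n) : (reshape_offset s (rho x) < nth 0 s (reshape_index s x))%N.
  by rewrite -ltn_col_len // len_rho ltn_col_len // (box_col_lt sum_s).
(* The row permutation that moves whole columns as rho does. *)
pose t0 x := box_of sum_s (lt_t x).
have t0_inj : injective t0.
  move=> x y eq_t; apply: (box_inj (s := s)).
    by have := congr1 (fun z : 'I_n => reshape_index s z) eq_t; rewrite !row_box_of.
  by have := congr1 (fun z : 'I_n => reshape_offset s z) eq_t; rewrite !col_box_of => /rho_col.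
pose t := perm t0_inj.
have row_t x : reshape_index s (t x) = reshape_index s x by rewrite permE row_box_of.
have col_t x : reshape_offset s (t x) = reshape_offset s (rho x).
  by rewrite permE col_box_of.
have Rt : t \in row_stab n s by apply/fun_stabP.
have Nt : t \in 'N(col_stab n s)%g.
  rewrite inE; apply/subsetP => _ /imsetP[q /fun_stabP Cq ->].
  apply/fun_stabP => x; rewrite conjgE !permM.
  by rewrite col_t -[x in RHS](permKV t) col_t; apply/colrho; rewrite Cq.
(* What remains of rho permutes each column in itself. *)
have Cq : (rho * t^-1)%g \in col_stab n s.
  by apply/fun_stabP => x; rewrite permM; apply/rho_col; rewrite -col_t permKV.
rewrite -(mulgKV t rho) repr_mxM ?inE // mulmxA specht_vector_col //.
rewrite -scalemxAl specht_vector_norm //.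
by case: (odd_perm _); rewrite ?scaleN1r ?scale1r; [right | left].
Qed.

(** * Columns as sets of labels: weights and multiplicities *)

Section Weights.

Variables (R : realFieldType) (X : finType) (w : X -> R) (eps : R).
Variable P : nat -> {set X}.
Hypothesis eps_gt0 : 0 < eps.
Hypothesis w_ge : forall z, eps <= w z.
Hypothesis card_P : forall l, (#|P l| <= l)%N.
Hypothesis gap_P : forall l z z', z \in P l -> z' \notin P l -> w z + eps <= w z'.

Definition weight (S : {set X}) := \sum_(z in S) w z.

(** Cancel the common elements.  What is left of [S] is at least as numerous as
what is left of [P #|S|], is not empty, and each of its elements weighs at
least [eps] more than each element removed. *)
Lemma weight_gap (S : {set X}) :
  weight (P #|S|) + eps *+ (S != P #|S|) <= weight S.
Proof.
have [<-|neSP] := eqVneq S (P #|S|); first by rewrite addr0.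
rewrite mulr1n; set Q := P #|S| in neSP *.
have cardD : (#|Q :\: S| <= #|S :\: Q|)%N.
  have := card_P #|S|; rewrite -/Q -(cardsID S Q) -[X in (_ <= X)%N](cardsID Q S).
  by rewrite setIC leq_add2l.
have [z0 SQz0] : exists z, z \in S :\: Q.
  apply/set0Pn; apply: contraNneq neSP => SQ0; rewrite SQ0 cards0 leqn0 in cardD.
  rewrite cards_eq0 setD_eq0 in cardD.
  by rewrite eqEsubset cardD -setD_eq0 SQ0 eqxx.
case: (arg_minP w SQz0) => z SQz min_z.
have /setDP[_ notQz] := SQz.
rewrite /weight (big_setID S) /= [in X in _ <= X](big_setID Q) /= setIC -addrA lerD2l.
have le1 : \sum_(y in Q :\: S) w y <= (w z - eps) *+ #|Q :\: S|.
  rewrite -sumr_const; apply: ler_sum => y /setDP[Qy _].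
  by rewrite lerBrDr; apply: gap_P notQz.
have le2 : w z *+ #|S :\: Q| <= \sum_(y in S :\: Q) w y.
  by rewrite -sumr_const; apply: ler_sum => y; apply: min_z.
apply: le_trans le2; apply: le_trans (lerD le1 (lexx eps)) _.
have -> : w z *+ #|S :\: Q| = (w z - eps) *+ #|S :\: Q| + eps *+ #|S :\: Q|.
  by rewrite -mulrnDl subrK.
have card_gt0 : (0 < #|S :\: Q|)%N by apply/card_gt0P; exists z.
apply: lerD; first by apply: ler_wpMn2l cardD; rewrite subr_ge0.
by rewrite -{1}[eps]mulr1n ler_wpMn2l // ltW.
Qed.

Variables (n : nat) (s : seq nat) (h : 'I_n -> X).
Hypotheses (sum_s : sumn s = n) (part_s : sorted geq s).
Hypothesis inj_h : forall x y : 'I_n,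
  reshape_offset s x = reshape_offset s y -> h x = h y -> x = y.

Definition col_set (c : nat) : {set X} :=
  [set h x | x in [set x : 'I_n | reshape_offset s x == c]].

Lemma card_col_set c : #|col_set c| = col_len s c.
Proof.
rewrite -(card_col sum_s part_s) card_in_imset // => x y.
by rewrite !inE => /eqP cx /eqP cy; apply: inj_h; rewrite cx cy.
Qed.

Lemma weight_cols :
  \sum_(x < n) w (h x) = \sum_(c < n) weight (col_set c).
Proof.
have lt_col (x : 'I_n) : (reshape_offset s x < n)%N.
  exact: leq_trans (box_col_lt sum_s x) (part_leq_sum sum_s _).
rewrite (partition_big (fun x => Ordinal (lt_col x)) predT) //=.
apply: eq_bigr => c _; rewrite /weight /col_set big_imset /=.
  by apply: eq_bigl => x; rewrite inE -val_eqE.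
by move=> x y; rewrite !inE => /eqP cx /eqP cy; apply: inj_h; rewrite cx cy.
Qed.

(** Each column whose set of labels is not the lightest of its size costs at least
[eps]. *)
Lemma weight_bad_cols :
  eps *+ #|[set c : 'I_n | col_set c != P #|col_set c|]|
    + \sum_(c < n) weight (P (col_len s c)) <= \sum_(x < n) w (h x).
Proof.
rewrite weight_cols -sumr_const big_mkcond -big_split /=.
apply: ler_sum => c _; have := weight_gap (col_set c).
rewrite inE card_col_set addrC.
by case: (_ == _).
Qed.
End Weights.

Section Classes.
Variables (X : finType) (P : nat -> {set X}) (K : nat).
Variables (n : nat) (s : seq nat).
Hypotheses (sum_s : sumn s = n) (part_s : sorted geq s).

Implicit Types h : 'I_n -> X.
Local Open Scope nat_scope.

(** Only the multiplicities of the sets that are not of the form [P l] are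
recorded: the other ones follow from the lengths of the columns.  With at most
[K] bad columns nothing is lost by truncating to ['I_K.+1]. *)
Definition bad_class h : {ffun {set X} -> 'I_K.+1} :=
  [ffun S => inord #|[set c : 'I_n | (col_set s h c == S) && (S != P #|S|)]|].

Definition col_injective h := forall x y : 'I_n,
  reshape_offset s x = reshape_offset s y -> h x = h y -> x = y.

(** The number of columns of length l is known, so the multiplicity of [P l] is
what the other sets of l labels leave over. *)
Lemma bad_class_mult h h' :
    col_injective h -> col_injective h' ->
    #|[set c : 'I_n | col_set s h c != P #|col_set s h c|]| <= K ->
    #|[set c : 'I_n | col_set s h' c != P #|col_set s h' c|]| <= K ->
    bad_class h = bad_class h' ->
  forall S, #|[set c : 'I_n | col_set s h c == S]|
          = #|[set c : 'I_n | col_set s h' c == S]|.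
Proof.
move=> inj_h inj_h' badK badK' eqb.
have multB (S : {set X}) : S != P #|S| ->
    #|[set c : 'I_n | col_set s h c == S]| = #|[set c : 'I_n | col_set s h' c == S]|.
  move=> badS.
  have := congr1 (fun f : {ffun {set X} -> 'I_K.+1} => nat_of_ord (f S)) eqb.
  have clE g : #|[set c : 'I_n | col_set s g c != P #|col_set s g c|]| <= K ->
      bad_class g S = #|[set c : 'I_n | col_set s g c == S]| :> nat.
    move=> badg; rewrite ffunE badS; under eq_finset => c do rewrite andbT.
    rewrite inordK // ltnS; apply: leq_trans badg.
    by apply/subset_leq_card/subsetP => c; rewrite !inE => /eqP ->.
  by move=> /= Ecl; rewrite -!clE.
move=> S; have [goodS|] := eqVneq S (P #|S|); last exact: multB.
have split g : col_injective g ->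
    #|[set c : 'I_n | col_len s c == #|S|]| = #|[set c : 'I_n | col_set s g c == S]|
     + \sum_(S' : {set X} | (#|S'| == #|S|) && (S' != S))
         #|[set c : 'I_n | col_set s g c == S']|.
  move=> inj_g; rewrite -(bigD1 (P := fun S' : {set X} => #|S'| == #|S|) S) //=.
  rewrite -[LHS]sum1_card (partition_big (fun c : 'I_n => col_set s g c)
    (fun S' : {set X} => #|S'| == #|S|)) /=.
    apply: eq_bigr => S' /eqP cS'; rewrite -[RHS]sum1_card; apply: eq_bigl => c.
    rewrite !inE; have [eS|] := eqVneq (col_set s g c) S'; last by rewrite andbF.
    by rewrite -cS' -eS (card_col_set sum_s part_s inj_g) eqxx.
  by move=> c; rewrite inE (card_col_set sum_s part_s inj_g).
have := split h inj_h; rewrite (split h' inj_h').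
have -> : \sum_(S' : {set X} | (#|S'| == #|S|) && (S' != S))
            #|[set c : 'I_n | col_set s h' c == S']|
        = \sum_(S' : {set X} | (#|S'| == #|S|) && (S' != S))
            #|[set c : 'I_n | col_set s h c == S']|.
  by apply: eq_bigr => S' /andP[/eqP cS' neS]; rewrite multB // cS' -goodS.
by move/eqP; rewrite eqn_add2r => /eqP ->.
Qed.

(** Equal multiplicities give a bijection between the columns that matches their
sets of labels; it lifts to the boxes because labels do not repeat in a column. *)
Lemma bad_class_perm h h' :
    col_injective h -> col_injective h' ->
    #|[set c : 'I_n | col_set s h c != P #|col_set s h c|]| <= K ->
    #|[set c : 'I_n | col_set s h' c != P #|col_set s h' c|]| <= K ->
    bad_class h = bad_class h' ->
  exists rho : 'S_n, (forall x, h (rho x) = h' x) /\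
    (forall x y : 'I_n, reshape_offset s x = reshape_offset s y <->
                        reshape_offset s (rho x) = reshape_offset s (rho y)).
Proof.
move=> inj_h inj_h' badK badK' eqb.
have mult := bad_class_mult inj_h inj_h' badK badK' eqb.
have [sigma sigmaE] : exists sigma : 'S_n, forall c : 'I_n,
    col_set s h' c = col_set s h (sigma c).
  have /tuple_permP[sigma Es] : perm_eq [tuple col_set s h' c | c < n]
                                        [tuple col_set s h c | c < n].
    apply/allP => S _ /=; apply/eqP.
    have cnt g : count_mem S [tuple col_set s g c | c < n]
               = #|[set c : 'I_n | col_set s g c == S]|.
      rewrite /= count_map -sum1_count big_enum_cond -[RHS]sum1_card.
      by apply: eq_bigl => c; rewrite inE.
    by rewrite !cnt mult.
  exists sigma => c.
  have := congr1 (fun t : n.-tuple {set X} => tnth t c) (val_inj Es).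
  by rewrite !tnth_mktuple.
have lt_col (x : 'I_n) : reshape_offset s x < n.
  exact: leq_trans (box_col_lt sum_s x) (part_leq_sum sum_s _).
pose oc x := Ordinal (lt_col x).
have /fin_all_exists[rho0 rhoE] (x : 'I_n) : exists y : 'I_n,
    h y = h' x /\ reshape_offset s y = sigma (oc x).
  have /imsetP[y] : h' x \in col_set s h (sigma (oc x)).
    by rewrite -sigmaE; apply: imset_f; rewrite inE.
  by rewrite inE => /eqP cy ->; exists y.
have col_rho (x y : 'I_n) : reshape_offset s x = reshape_offset s y <->
    reshape_offset s (rho0 x) = reshape_offset s (rho0 y).
  rewrite !(rhoE _).2; split=> [eqc | /val_inj /perm_inj /(congr1 val) //].
  by congr (val (sigma _)); apply: val_inj.
have rho_inj : injective rho0.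
  move=> x y eq_rho; apply: inj_h'; first by apply/col_rho; rewrite eq_rho.
  by rewrite -!(rhoE _).1 eq_rho.
exists (perm rho_inj); split=> [x | x y]; rewrite !permE; first exact: (rhoE x).1.
exact: col_rho.
Qed.
End Classes.

(** * An upper bound for the multiplicity of the trivial representation *)

Section KroneckerBound.

Variables (C : numClosedFieldType) (N n : nat) (lam mu nu : seq nat).
Local Notation X := ('I_N.+1 * 'I_N.+1)%type.
Local Notation r1 := (specht_repr C n lam).
Local Notation r2 := (specht_repr C n mu).
Local Notation r3 := (specht_repr C n nu).

(** The labelling of the boxes of [lam] that determines the tensor of a pair: the
rows of the boxes of [mu] and [nu] only matter because of [tabloid_vector_row]. *)
Definition label (g : 'S_n * 'S_n) (x : 'I_n) : X :=
  (inord (reshape_index mu (g.1^-1 x)%g), inord (reshape_index nu (g.2^-1 x)%g)).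

Definition label_tensor :=
  orbit_tensor r1 r2 r3 (specht_vector C n lam)
    (tabloid_vector C n mu) (tabloid_vector C n nu).

Hypotheses (sum_lam : sumn lam = n) (sum_mu : sumn mu = n) (sum_nu : sumn nu = n).
Hypothesis part_lam : sorted geq lam.
Hypotheses (size_mu : (size mu <= N.+1)%N) (size_nu : (size nu <= N.+1)%N).

Lemma tabloid_vector_eq s (g h : 'S_n) :
    (forall x : 'I_n, reshape_index s (g^-1 x)%g = reshape_index s (h^-1 x)%g) ->
  tabloid_vector C n s *m specht_repr C n s g = tabloid_vector C n s *m specht_repr C n s h.
Proof.
move=> eq_row.
have Rp : (g * h^-1)%g \in row_stab n s.
  by apply/fun_stabP => x; rewrite permM -eq_row permK.
by rewrite -(mulgKV h g) repr_mxM ?inE // [LHS]mulmxA tabloid_vector_row.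
Qed.

Lemma inord_row_inj s (x y : 'I_n) : sumn s = n -> (size s <= N.+1)%N ->
    inord (reshape_index s x) = inord (reshape_index s y) :> 'I_N.+1 ->
  reshape_index s x = reshape_index s y.
Proof.
move=> sum_s size_s /(congr1 val); rewrite /= !inordK //.
  exact: leq_trans (box_row_lt sum_s y) size_s.
exact: leq_trans (box_row_lt sum_s x) size_s.
Qed.

(** Two pairs whose labellings differ by [rho] have tensors that differ by the
action of [rho^-1] on the last two factors, which can be moved to the first. *)
Lemma label_tensor_perm g h (rho : 'S_n) :
    (forall x, label g (rho x) = label h x) ->
  label_tensor h = invariant_tensor r1 r2 r3 (specht_vector C n lam *m r1 rho)
    (tabloid_vector C n mu *m r2 g.1) (tabloid_vector C n nu *m r3 g.2).
Proof.
move=> Lgh; rewrite /label_tensor /orbit_tensor.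
rewrite (tabloid_vector_eq (g := h.1) (h := (g.1 * rho^-1)%g)); last first.
  move=> x; have [/(inord_row_inj sum_mu size_mu) <- _] := Lgh x.
  by rewrite invMg invgK permM.
rewrite (tabloid_vector_eq (g := h.2) (h := (g.2 * rho^-1)%g)); last first.
  move=> x; have [_ /(inord_row_inj sum_nu size_nu) <-] := Lgh x.
  by rewrite invMg invgK permM.
rewrite -(invariant_tensorJ r1 r2 r3 _ _ _ (in_setT rho)); congr invariant_tensor.
  by rewrite -[LHS]mulmxA -repr_mxM ?inE // mulgKV.
by rewrite -[LHS]mulmxA -repr_mxM ?inE // mulgKV.
Qed.

Lemma invariant_tensorN u v w :
  invariant_tensor r1 r2 r3 (- u) v w = - invariant_tensor r1 r2 r3 u v w.
Proof. by rewrite -scaleN1r invariant_tensorZ scaleN1r. Qed.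

(** If two boxes of a column carry the same label, exchanging them changes the
sign of the tensor but not its labelling. *)
Lemma label_tensor_col_injective g : label_tensor g != 0 -> col_injective lam (label g).
Proof.
move=> nz x y col_xy Lxy; apply/eqP; apply: contraNT nz => nexy.
have Ct : tperm x y \in col_stab n lam.
  by apply/fun_stabP => z; case: tpermP => // ->.
have Lt z : label g (tperm x y z) = label g z by case: tpermP => // ->.
have := label_tensor_perm Lt; rewrite specht_vector_col // odd_tperm nexy.
rewrite scaleN1r invariant_tensorN => /eqP.
by rewrite -addr_eq0 -mulr2n -scaler_nat scaler_eq0 pnatr_eq0.
Qed.

Variables (R : realFieldType) (wx wy : nat -> R) (eps : R) (K : nat).
Variable P : nat -> {set X}.
Let w (z : X) : R := wx z.1 + wy z.2.
Hypotheses (eps_gt0 : 0 < eps) (w_ge : forall z, eps <= w z).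
Hypothesis card_P : forall l, (#|P l| <= l)%N.
Hypothesis gap_P : forall l z z', z \in P l -> z' \notin P l -> w z + eps <= w z'.
Hypothesis total_weight :
  \sum_(r < N.+1) wx r *+ nth 0%N mu r + \sum_(r < N.+1) wy r *+ nth 0%N nu r
  <= \sum_(c < n) weight w (P (col_len lam c)) + eps *+ K.

Lemma label_weight g : \sum_(x < n) w (label g x) =
  \sum_(r < N.+1) wx r *+ nth 0%N mu r + \sum_(r < N.+1) wy r *+ nth 0%N nu r.
Proof.
rewrite -(sum_row sum_mu) // -(sum_row sum_nu) // big_split /=.
rewrite (reindex_inj (@perm_inj _ g.1)) /= [X in _ + X](reindex_inj (@perm_inj _ g.2)) /=.
by congr (_ + _); apply: eq_bigr => x _; rewrite permK inordK //;
  [apply: leq_trans (box_row_lt sum_mu x) _ | apply: leq_trans (box_row_lt sum_nu x) _].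
Qed.

(** The weight of a labelling depends only on its marginals [mu] and [nu], and
[total_weight] leaves room for at most [K] columns heavier than necessary. *)
Lemma label_bad_cols g : col_injective lam (label g) ->
  (#|[set c : 'I_n | col_set lam (label g) c != P #|col_set lam (label g) c|]| <= K)%N.
Proof.
move=> inj_g.
have := weight_bad_cols eps_gt0 w_ge card_P gap_P sum_lam part_lam inj_g.
rewrite label_weight => /le_trans/(_ total_weight).
by rewrite [X in _ <= X]addrC lerD2r (ler_pMn2l eps_gt0).
Qed.

Lemma rank_rfix_le :
  (\rank (rfix_mx (prod_repr (prod_repr r1 r2) r3) [set: 'S_n])
    <= #|{ffun {set X} -> 'I_K.+1}|)%N.
Proof.
apply: (@rank_rfix_classes C _ [set: 'S_n]%G _ _ _ r1 r2 r3 (specht_vector C n lam)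
  (tabloid_vector C n mu) (tabloid_vector C n nu) _
  (fun g => bad_class P K lam (label g))).
- by rewrite pnatr_eq0 -lt0n cardG_gt0.
- exact: specht_vector_cyclic.
- exact: tabloid_vector_cyclic.
- exact: tabloid_vector_cyclic.
move=> g h _ _ _ _ nzg nzh eq_cl.
have inj_g := label_tensor_col_injective nzg.
have inj_h := label_tensor_col_injective nzh.
have [rho [Lgh col_rho]] := bad_class_perm sum_lam part_lam inj_h inj_g
  (label_bad_cols inj_h) (label_bad_cols inj_g) (esym eq_cl).
rewrite -/(label_tensor g) (label_tensor_perm Lgh).
have [->|->] := specht_vector_colperm C sum_lam part_lam col_rho; first exact: submx_refl.
by rewrite invariant_tensorN eqmx_opp submx_refl.
Qed.

End KroneckerBound.

(** * A signed count in the symmetric group *)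

Section SignedCount.
Variable n : nat.
Local Notation gT := 'S_n.
Implicit Types (H K : {group gT}).
Local Notation sg q := ((-1) ^+ odd_perm q : int).

(** Coefficient at [g] of the product of the sum over [A] and the signed sum
over [B]. *)
Definition young_coef (A B : {set gT}) (g : gT) : int :=
  \sum_(p in A) \sum_(q in B) sg q * (p * q == g)%g%:R.

(** With A the sum of [H] and B the signed sum of [K], this is the coefficient of 1
in A B A B. *)
Definition signed_count H K : int :=
  \sum_(s in H) \sum_(p in K) \sum_(q in K) \sum_(t in H)
    sg p * sg q * (s * p == q * t)%g%:R.

(** Coefficient at [g] of A B A, for the same A and B. *)
Definition sandwich_coef H K (g : gT) : int :=
  \sum_(s in H) \sum_(p in K) \sum_(t in H) sg p * (s * p * t == g)%g%:R.

Lemma sum_deltaM (x y : gT) :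
  \sum_(g : gT) (x == g)%:R * (y == g)%:R = (x == y)%:R :> int.
Proof.
rewrite (bigD1 x) //= eqxx mul1r big1 ?addr0 => [|g /negPf]; first by rewrite eq_sym.
by rewrite eq_sym => ->; rewrite mul0r.
Qed.

(** The squared norm of A B A is the coefficient of 1 in
(A B A) (A B A) = |H| A B A B A, and a cyclic shift merges two more factors A. *)
Lemma sandwich_norm H K :
  \sum_g sandwich_coef H K g ^+ 2 = signed_count H K *+ (#|H| * #|H|).
Proof.
have -> : \sum_g sandwich_coef H K g ^+ 2 =
    \sum_(s in H) \sum_(p in K) \sum_(t in H) \sum_(s' in H) \sum_(q in K) \sum_(t' in H)
      sg p * sg q * (s * p * t == s' * q * t')%g%:R.
  under eq_bigr => g _ do rewrite expr2 {1}/sandwich_coef mulr_suml.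
  rewrite exchange_big /=; apply: eq_bigr => s _.
  under eq_bigr => g _ do rewrite mulr_suml.
  rewrite exchange_big /=; apply: eq_bigr => p _.
  under eq_bigr => g _ do rewrite mulr_suml.
  rewrite exchange_big /=; apply: eq_bigr => t _.
  under eq_bigr => g _ do rewrite /sandwich_coef mulr_sumr.
  rewrite exchange_big /=; apply: eq_bigr => s' _.
  under eq_bigr => g _ do rewrite mulr_sumr.
  rewrite exchange_big /=; apply: eq_bigr => q _.
  under eq_bigr => g _ do rewrite mulr_sumr.
  rewrite exchange_big /=; apply: eq_bigr => t' _.
  by under eq_bigr => g _ do rewrite mulrACA; rewrite -mulr_sumr sum_deltaM.
(* The equation s p t = s' q t' is brought to s p = q t' by replacing s by s' s and t' by t' t. *)
transitivity (\sum_(t in H) \sum_(s' in H) signed_count H K); last first.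
  by rewrite !sumr_const -mulrnA.
under eq_bigr => s _ do rewrite exchange_big /=.
rewrite exchange_big /=; apply: eq_bigr => t Ht.
under eq_bigr => s _ do rewrite exchange_big /=.
rewrite exchange_big /=; apply: eq_bigr => s' Hs'.
rewrite (reindex_inj (mulgI s')) /=.
apply: eq_big => s; first by rewrite groupMl.
move=> _; apply: eq_bigr => p _; apply: eq_bigr => q _.
rewrite (reindex_inj (mulIg t)) /=.
apply: eq_big => t'; first by rewrite groupMr.
by rewrite !mulgA (inj_eq (mulIg t)) -!(mulgA s') (inj_eq (mulgI s')).
Qed.

(** The coefficient of A B A at 1 is |H|: as [H] and [K] meet trivially, only the
products with p = 1 contribute. *)
Lemma signed_count_gt0 H K : H :&: K = 1%g -> 0 < signed_count H K.
Proof.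
move=> tiHK; have HH : (0 < #|H| * #|H|)%N by rewrite muln_gt0 cardG_gt0.
rewrite -(pmulrn_lgt0 _ HH) -sandwich_norm.
have coef1 : sandwich_coef H K 1%g = #|H|%:R.
  rewrite /sandwich_coef -sumr_const; apply: eq_bigr => s Hs.
  rewrite (bigD1 1%g) //= (bigD1 s^-1%g) ?groupV //= mulg1 mulgV odd_perm1 eqxx mulr1.
  rewrite big1 => [|t /andP[_ net]]; last first.
    by rewrite -eq_invg_mul eq_sym (negPf net) mulr0.
  rewrite big1 ?addr0 // => p /andP[Kp nep]; apply: big1 => t Ht.
  case: eqP => [spt|]; last by rewrite mulr0.
  case/eqP: nep; apply/set1P; rewrite -[[set _]]tiHK inE Kp andbT.
  have -> : p = (s^-1 * t^-1)%g by rewrite -[p](mulKg s) -[X in _ = (_ * X)%g]mul1g -spt mulgK.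
  by rewrite groupM ?groupV.
rewrite (bigD1 1%g) //= coef1 ltr_pwDl ?exprn_gt0 ?ltr0n ?cardG_gt0 //.
by apply: sumr_ge0 => g _; apply: sqr_ge0.
Qed.

Lemma young_coefMl (A : {group gT}) (B : {set gT}) a g :
  a \in A -> young_coef A B (a * g)%g = young_coef A B g.
Proof.
move=> Aa; rewrite /young_coef (reindex_inj (mulgI a)) /=.
apply: eq_big => p; first by rewrite groupMl.
by move=> _; apply: eq_bigr => q _; rewrite -mulgA (inj_eq (mulgI a)).
Qed.

(** If p q = g with q and g in [D], then p is in [D] as well. *)
Lemma young_coef_sub (A B D A' : {group gT}) g :
    B \subset D -> A :&: D = A' -> g \in D ->
  young_coef A B g = young_coef A' B g.
Proof.
move=> sBD AD Dg; rewrite /young_coef (bigID (mem D)) /= [X in _ + X]big1 ?addr0.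
  by apply: eq_bigl => p; rewrite -AD inE.
move=> p /andP[_ notDp]; apply: big1 => q Bq.
case: eqP => [pqg|]; last by rewrite mulr0.
by rewrite -(groupMr _ (subsetP sBD q Bq)) pqg Dg in notDp.
Qed.

(** Write g = p q with p in [R1] and q in [C1].  The other two factors do not see
p, and on [C1] only the parts of their row groups inside [C1], which are [C3]
and [C2], contribute. *)
Lemma sum_young_coef3 (R1 C1 R2 C2 R3 C3 : {group gT}) :
    R1 \subset R2 -> R1 \subset R3 -> C2 \subset C1 -> C3 \subset C1 ->
    R2 :&: C1 = C3 -> R3 :&: C1 = C2 -> C3 :&: C2 = 1%g ->
  0 < \sum_g young_coef R1 C1 g * young_coef R2 C2 g * young_coef R3 C3 g.
Proof.
move=> sR12 sR13 sC21 sC31 RC2 RC3 ti.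
suff -> : \sum_g young_coef R1 C1 g * young_coef R2 C2 g * young_coef R3 C3 g
          = signed_count C3 C2 *+ #|R1|.
  by rewrite pmulrn_lgt0 ?cardG_gt0 ?signed_count_gt0.
have delta_sum (F : gT -> int) y : \sum_g (y == g)%:R * F g = F y.
  rewrite (bigD1 y) //= eqxx mul1r big1 ?addr0 // => g /negPf.
  by rewrite eq_sym => ->; rewrite mul0r.
rewrite -sumr_const.
under eq_bigr => g _ do rewrite -mulrA {1}/young_coef mulr_suml.
rewrite exchange_big /=; apply: eq_bigr => p R1p.
transitivity (\sum_(q in C1) sg q * (young_coef R2 C2 q * young_coef R3 C3 q)).
  under eq_bigr => g _ do rewrite mulr_suml.
  rewrite exchange_big /=; apply: eq_bigr => q _.
  under eq_bigr => g _ do rewrite -mulrA.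
  rewrite -mulr_sumr delta_sum !young_coefMl //; first exact: (subsetP sR13).
  exact: (subsetP sR12).
transitivity (\sum_(q in C1) sg q * (young_coef C3 C2 q * young_coef C2 C3 q)).
  by apply: eq_bigr => q C1q; rewrite (young_coef_sub sC21 RC2) // (young_coef_sub sC31 RC3).
rewrite /signed_count.
under eq_bigr => q _ do rewrite mulrCA {1}/young_coef mulr_suml.
rewrite exchange_big /=; apply: eq_bigr => s C3s.
under eq_bigr => q _ do rewrite mulr_suml.
rewrite exchange_big /=; apply: eq_bigr => u C2u.
under eq_bigr => q _ do rewrite /young_coef !mulr_sumr.
rewrite exchange_big /=; apply: eq_bigr => v C2v.
under eq_bigr => q _ do rewrite !mulr_sumr.
rewrite exchange_big /=; apply: eq_bigr => t C3t.
have C1vt : (v * t)%g \in C1 by rewrite groupM ?(subsetP sC21 v) ?(subsetP sC31 t).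
rewrite (bigD1 (v * t)%g) //= big1 ?addr0 => [|q /andP[_ /negPf neq]]; last first.
  by rewrite [(v * t == q)%g]eq_sym neq !mulr0.
rewrite eqxx mulr1 odd_permM signr_addb.
by rewrite -[X in _ * X]mulrA -signr_addb addbb mulr1 mulrAC.
Qed.
End SignedCount.

(** * Tableaux with prescribed rows and columns *)

Section Fillings.
Variables (n : nat).

(** [g] carries a filling with rows [r] and columns [k] to the numbering of the
diagram of [s] used for its Young symmetrizer; the names of the columns do
not matter, only which boxes share a column. *)
Definition filling_perm (K : eqType) (s : seq nat) (r : 'I_n -> nat) (k : 'I_n -> K)
    (g : 'S_n) : Prop :=
  (forall x, reshape_index s (g x) = r x) /\
  (forall x y, reshape_offset s (g x) = reshape_offset s (g y) <-> k x = k y).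

Section Exists.
Local Open Scope nat_scope.
Variables (K : eqType) (s : seq nat) (r : 'I_n -> nat) (k : 'I_n -> K).
Hypothesis sum_s : sumn s = n.
Hypothesis inj_rk : forall x y, r x = r y -> k x = k y -> x = y.
Hypothesis content_r : forall i, #|[set x | r x == i]| = nth 0 s i.
Hypothesis down_rk : forall x i, i < r x -> exists y, r y = i /\ k y = k x.

Let height (kap : K) := #|[set x | k x == kap]|.

(** The column of [x] has a box in each row up to that of [x]. *)
Lemma ltn_height x : r x < height (k x).
Proof.
have /fin_all_exists[f fE] (i : 'I_(r x).+1) : exists y, r y = i /\ k y = k x.
  by have := ltn_ord i; rewrite ltnS leq_eqVlt => /predU1P[->|/down_rk//]; exists x.
have f_inj : injective f.
  by move=> i j eqf; apply: val_inj; rewrite /= -!(fE _).1 eqf.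
rewrite -[X in X <= _]card_ord -(card_imset _ f_inj).
by apply/subset_leq_card/subsetP => _ /imsetP[i _ ->]; rewrite inE (fE i).2.
Qed.

Lemma height_ex kap i : i < height kap -> exists2 y, r y = i & k y = kap.
Proof.
move=> lt_i; pose A := [set x | k x == kap].
(* A column without a box in row i has all its boxes in rows before i, so at most i of them. *)
suff /existsP[y /andP[/eqP ry /eqP ky]] : [exists y, (r y == i) && (k y == kap)] by exists y.
apply: contraLR lt_i => /existsPn no_y; rewrite -leqNgt.
have lt_r x : x \in A -> r x < i.
  rewrite inE => /eqP kx; rewrite ltnNge leq_eqVlt.
  apply/negP => /predU1P[ix | /down_rk[y [ry ky]]].
    by have := no_y x; rewrite ix kx !eqxx.
  by have := no_y y; rewrite ry ky kx !eqxx.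
have uniq_rA : uniq [seq r x | x in A].
  rewrite map_inj_in_uniq ?enum_uniq // => x y; rewrite !mem_enum !inE => /eqP kx /eqP ky.
  by move=> eqr; apply: inj_rk => //; rewrite kx ky.
have := uniq_leq_size (s2 := iota 0 i) uniq_rA; rewrite size_iota size_map -cardE.
by apply=> _ /imageP[x Ax ->]; rewrite mem_iota lt_r.
Qed.

Let key_le (a b : K) := height b <= height a.
Let keys := sort key_le (undup [seq k x | x : 'I_n]).
Let pos x := index (k x) keys.

Lemma mem_keys kap : (kap \in keys) = (kap \in [seq k x | x : 'I_n]).
Proof. by rewrite mem_sort mem_undup. Qed.

Lemma key_in_keys x : k x \in keys.
Proof. by rewrite mem_keys; apply: image_f. Qed.

(** Every column up to that of [x] is at least as high, hence meets the row of
[x]; so there are at most as many of them as boxes in this row. *)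
Lemma ltn_pos x : pos x < nth 0 s (r x).
Proof.
have lt_px : pos x < size keys by rewrite index_mem key_in_keys.
rewrite -content_r -(size_takel (s := keys) lt_px) cardE -(size_map k).
have uniq_keys : uniq keys by rewrite sort_uniq undup_uniq.
apply: uniq_leq_size => [|kap]; first exact: take_uniq.
move=> kap_in; have kap_keys : kap \in keys by apply: mem_take kap_in.
have le_pos : index kap keys <= pos x by rewrite -ltnS index_ltn.
have trans_le : transitive key_le by move=> a b c le1 le2; apply: leq_trans le2 le1.
have tot_le : total key_le by move=> a b; apply: leq_total.
have sorted_keys : sorted key_le keys by apply: sort_sorted.
have : height (k x) <= height kap.
  have := sorted_leq_nth trans_le (fun a => leqnn (height a)) (k x) sorted_keys.
  move/(_ (index kap keys) (pos x)); rewrite !inE index_mem kap_keys lt_px.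
  by move=> /(_ isT isT le_pos); rewrite /key_le !nth_index ?key_in_keys.
move=> /(leq_trans (ltn_height x)) /height_ex[y ry ky].
by apply/mapP; exists y => //; rewrite mem_enum inE ry.
Qed.

(** Order the columns by decreasing height.  The columns higher than i then come
first, and there are as many of them as boxes in row i, so that each row fills
an initial segment. *)
Lemma filling_perm_exists : exists g : 'S_n, filling_perm s r k g.
Proof.
have pos_inj x y : pos x = pos y -> k x = k y.
  by move=> eqp; rewrite -(nth_index (k x) (key_in_keys x)) -/(pos x) eqp
    nth_index ?key_in_keys.
have g_inj : injective (fun x => box_of sum_s (ltn_pos x)).
  move=> x y eqg; apply: inj_rk.
    by have := congr1 (fun z : 'I_n => reshape_index s z) eqg; rewrite !row_box_of.
  apply: pos_inj.
  by have := congr1 (fun z : 'I_n => reshape_offset s z) eqg; rewrite !col_box_of.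
exists (perm g_inj); split=> [x | x y]; rewrite !permE ?row_box_of // !col_box_of.
by split=> [/pos_inj //|]; rewrite /pos => ->.
Qed.
End Exists.

Lemma filling_perm_ord (K : eqType) (s : seq nat) m (r : 'I_n -> 'I_m) (k : 'I_n -> K) :
    sumn s = n -> (size s <= m)%N ->
    (forall x y, r x = r y -> k x = k y -> x = y) ->
    (forall i, #|[set x | r x == i]| = nth 0%N s i) ->
    (forall x (i : 'I_m), (i < r x)%N -> exists y, r y = i /\ k y = k x) ->
  exists g : 'S_n, filling_perm s (fun x => r x : nat) k g.
Proof.
move=> sum_s size_s inj content down; apply: filling_perm_exists => //.
- by move=> x y /val_inj; apply: inj.
- move=> i; case: (ltnP i m) => [lt_i|le_i]; first by rewrite -(content (Ordinal lt_i)).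
  rewrite nth_default ?(leq_trans size_s) //; apply/eqP; rewrite cards_eq0 -subset0.
  by apply/subsetP => x; rewrite inE => /eqP ix; rewrite -ix leqNgt ltn_ord in le_i.
move=> x i lt_i; have [y [ry ky]] := down x (Ordinal (ltn_trans lt_i (ltn_ord _))) lt_i.
by exists y; rewrite ry.
Qed.

Lemma young_coef_filling (K : eqType) s r (k : 'I_n -> K) g x :
    filling_perm s r k g ->
  young_coef (row_stab n s) (col_stab n s) (x ^ g)%g
  = young_coef (fun_stab r) (fun_stab k) x.
Proof.
move=> [row_g col_g]; rewrite /young_coef (reindex_inj (conjg_inj g)) /=.
apply: eq_big => p.
  apply/fun_stabP/fun_stabP => stab y.
    by have := stab (g y); rewrite conjgE !permM permK !row_g.
  by rewrite conjgE !permM -{2}(permKV g y) !row_g stab.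
move=> _; rewrite (reindex_inj (conjg_inj g)) /=.
apply: eq_big => q.
  apply/fun_stabP/fun_stabP => stab y.
    by have := stab (g y); rewrite conjgE !permM permK => /col_g.
  by rewrite conjgE !permM -{2}(permKV g y); apply/col_g; rewrite stab.
by move=> _; rewrite odd_permJ -conjMg (inj_eq (conjg_inj g)).
Qed.

Lemma fun_stab_capM (T1 T2 : eqType) (f1 : 'I_n -> T1) (f2 : 'I_n -> T2) :
  fun_stab f1 :&: fun_stab f2 = fun_stab (fun x => (f1 x, f2 x)).
Proof.
apply/setP => s; rewrite inE; apply/andP/fun_stabP => [[/fun_stabP e1 /fun_stabP e2] x|e12].
  by rewrite e1 e2.
by split; apply/fun_stabP => x; case: (e12 x).
Qed.

(** The coordinate at (g1^-1, g2^-1, g3^-1) of the invariant tensor made of the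
three Young symmetrizers, translated by the same elements, is the sum of
[sum_young_coef3]. *)
Lemma rank_rfix_fillings (C : numClosedFieldType) (K1 K2 K3 : eqType)
    (s1 s2 s3 : seq nat) (r1 r2 r3 : 'I_n -> nat)
    (k1 : 'I_n -> K1) (k2 : 'I_n -> K2) (k3 : 'I_n -> K3) (g1 g2 g3 : 'S_n) :
    filling_perm s1 r1 k1 g1 -> filling_perm s2 r2 k2 g2 -> filling_perm s3 r3 k3 g3 ->
    fun_stab r1 \subset fun_stab r2 -> fun_stab r1 \subset fun_stab r3 ->
    fun_stab k2 \subset fun_stab k1 -> fun_stab k3 \subset fun_stab k1 ->
    fun_stab r2 :&: fun_stab k1 = fun_stab k3 ->
    fun_stab r3 :&: fun_stab k1 = fun_stab k2 ->
    fun_stab k3 :&: fun_stab k2 = 1%g ->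
  \rank (rfix_mx (prod_repr (prod_repr (specht_repr C n s1) (specht_repr C n s2))
                            (specht_repr C n s3)) [set: 'S_n]) != 0%N.
Proof.
move=> fill1 fill2 fill3 sr12 sr13 sk21 sk31 rk2 rk3 tik.
pose f s (g : 'S_n) := val_submod 1%:M *m (@regular_basis C _ [set: 'S_n]%G g^-1%g)^T
  : 'cV_(\rank (cyclic_mx (regular_repr C [set: 'S_n]%G) (young_vector C n s))).
pose u s (g : 'S_n) := specht_vector C n s *m specht_repr C n s g^-1%g.
apply: (@invariant_tensor_coord _ _ [set: 'S_n]%G _ _ _ (specht_repr C n s1)
  (specht_repr C n s2) (specht_repr C n s3) (f s1 g1) (f s2 g2) (f s3 g3)
  (u s1 g1) (u s2 g2) (u s3 g3)).
have coord (K : eqType) s r (k : 'I_n -> K) g x : filling_perm s r k g ->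
    (u s g *m specht_repr C n s x *m f s g) 0 0
    = (young_coef (fun_stab r) (fun_stab k) x^-1%g)%:~R.
  move=> fill; rewrite /f mulmxA -val_submodE /u -mulmxA -repr_mxM ?inE //.
  rewrite val_specht_vectorJ young_vector_coord -(young_coef_filling _ fill).
  rewrite /young_coef rmorph_sum; apply: eq_bigr => p _.
  rewrite rmorph_sum; apply: eq_bigr => q _.
  by rewrite rmorphM rmorph_sign /= natz conjgE !invMg invgK !mulgA.
rewrite (eq_bigr (fun x => (young_coef (fun_stab r1) (fun_stab k1) x^-1%g *
   young_coef (fun_stab r2) (fun_stab k2) x^-1%g *
   young_coef (fun_stab r3) (fun_stab k3) x^-1%g)%:~R)); last first.
  by move=> x _; rewrite !(coord _ _ _ _ _ _ fill1, coord _ _ _ _ _ _ fill2,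
    coord _ _ _ _ _ _ fill3) !rmorphM.
rewrite -rmorph_sum intr_eq0 (reindex_inj invg_inj) /=.
under eq_bigr => x _ do rewrite invgK.
rewrite (eq_bigl predT) => [|x]; last by rewrite inE.
by rewrite gt_eqF // sum_young_coef3.
Qed.
End Fillings.

(** * Marginals of a standard tableau and non-vanishing *)

Section Partitions.
Local Open Scope nat_scope.

Lemma sorted_geq_nth s :
  (forall i j, i <= j -> nth 0 s j <= nth 0 s i) -> sorted geq s.
Proof. by move=> le_s; apply/(sortedP 0) => i _; apply: le_s. Qed.

(** In a weakly decreasing sequence only trailing zeros are removed, and they agree
with the default value. *)
Lemma nth_trim s i : sorted geq s -> nth 0 (trim s) i = nth 0 s i.
Proof.
elim: s i => [|m s IHs] i //= part_ms; have part_s := path_sorted part_ms.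
have [m0|m_gt0] := posnP m; last by case: i => [|i] //=; apply: IHs.
have all0 : all (fun m' => m' == 0) s.
  apply: sub_all (order_path_min geq_transitive part_ms) => m'.
  by rewrite m0 /geq /= leqn0.
have -> : trim s = [::].
  by apply/eqP; rewrite -[_ == _]negbK -has_filter -all_predC; apply: sub_all all0 => ? /=; rewrite negbK.
rewrite nth_nil; case: i => [|i] //=.
case: (ltnP i (size s)) => [lt_i | ?]; last by rewrite nth_default.
by move/all_nthP: all0 => /(_ 0 i lt_i)/eqP.
Qed.

Lemma trim_partition s : sorted geq s -> is_partition (trim s).
Proof.
move=> part_s; rewrite /is_partition mem_filter eqxx andbT.
exact: sorted_filter geq_transitive _ _ part_s.
Qed.

Lemma sumn_trim s : sumn (trim s) = sumn s.
Proof. by elim: s => [|[|m] s IHs] //=; rewrite IHs. Qed.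

Lemma size_trim s : size (trim s) <= size s.
Proof. by rewrite size_filter count_size. Qed.

Lemma sumn_nth s N : size s <= N -> sumn s = \sum_(r < N) nth 0 s r.
Proof.
move=> le_sN; have := @sum_row _ s erefl _ (fun=> 1) N le_sN.
by rewrite sum1_card card_ord => ->; apply: eq_bigr => r _; rewrite natn.
Qed.

Lemma nth_addp s t i : nth 0 (addp s t) i = nth 0 s i + nth 0 t i.
Proof.
rewrite /addp; case: (ltnP i (maxn (size s) (size t))) => [?|]; first by rewrite nth_mkseq.
by move=> le_i; move: (le_i); rewrite geq_max => /andP[? ?]; rewrite !nth_default ?size_mkseq.
Qed.

Lemma nth_scalep k s i : sorted geq s -> nth 0 (scalep k s) i = k * nth 0 s i.
Proof.
move=> part_s; rewrite nth_trim.
  case: (ltnP i (size s)) => [?|?]; first by rewrite (nth_map 0).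
  by rewrite !nth_default ?size_map // muln0.
by apply: homo_sorted part_s => x y le; apply: leq_mul.
Qed.

Lemma addp_sorted k s t : sorted geq s -> sorted geq t -> sorted geq (addp s (scalep k t)).
Proof.
move=> part_s part_t; apply: sorted_geq_nth => i j le_ij.
by rewrite !nth_addp !nth_scalep // leq_add ?leq_mul2l ?part_leq ?orbT.
Qed.

Lemma size_addp_scalep k s t : size (addp s (scalep k t)) <= maxn (size s) (size t).
Proof.
rewrite size_mkseq geq_max leq_maxl leq_max.
by apply/orP; right; rewrite (leq_trans (size_trim _)) // size_map.
Qed.

Section FamilyPartition.
Variables (m : nat) (F : 'I_m -> nat).
Hypothesis F_mono : forall i j : 'I_m, i < j -> F j <= F i.
Local Notation s := [seq F i | i <- enum 'I_m].

Lemma nth_family (i : 'I_m) : nth 0 s i = F i.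
Proof. by rewrite (nth_map i) ?size_enum_ord // nth_ord_enum. Qed.

Lemma family_sorted : sorted geq s.
Proof.
apply/(sortedP 0) => i; rewrite size_map size_enum_ord => lt_i.
by rewrite (nth_family (Ordinal lt_i)) (nth_family (Ordinal (ltnW lt_i))); apply: F_mono.
Qed.

Lemma nth_trim_family (i : 'I_m) : nth 0 (trim s) i = F i.
Proof. by rewrite nth_trim ?family_sorted // nth_family. Qed.

Lemma size_trim_family : size (trim s) <= m.
Proof. by rewrite (leq_trans (size_trim _)) // size_map size_enum_ord. Qed.

Lemma sumn_trim_family : sumn (trim s) = \sum_i F i.
Proof. by rewrite sumn_trim sumnE big_map big_enum. Qed.

End FamilyPartition.
End Partitions.

Section Tableau.

Variables (a b : nat) (T : 'I_a * 'I_b -> 'I_(a * b)) (lam : seq nat).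
Hypothesis hT : standard_tableau T.
Hypothesis part_lam : sorted geq lam.
Hypothesis size_lam : (size lam <= a * b)%N.

Let rowsum (i : 'I_a) := (\sum_(j < b) nth 0 lam (T (i, j)))%N.
Let colsum (j : 'I_b) := (\sum_(i < a) nth 0 lam (T (i, j)))%N.

Lemma rowsum_mono (i k : 'I_a) : (i < k)%N -> (rowsum k <= rowsum i)%N.
Proof.
case: hT => _ _ Tcol lt_ik; apply: leq_sum => j _.
by apply: part_leq part_lam _ _ _; apply: ltnW; apply: Tcol.
Qed.

Lemma colsum_mono (j l : 'I_b) : (j < l)%N -> (colsum l <= colsum j)%N.
Proof.
case: hT => _ Trow _ lt_jl; apply: leq_sum => i _.
by apply: part_leq part_lam _ _ _; apply: ltnW; apply: Trow.
Qed.

Lemma nth_aT (i : 'I_a) : nth 0%N (aT T lam) i = rowsum i.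
Proof. exact: (nth_trim_family rowsum_mono). Qed.

Lemma nth_bT (j : 'I_b) : nth 0%N (bT T lam) j = colsum j.
Proof. exact: (nth_trim_family colsum_mono). Qed.

Lemma aT_partition : is_partition (aT T lam).
Proof. exact: trim_partition (family_sorted rowsum_mono). Qed.

Lemma bT_partition : is_partition (bT T lam).
Proof. exact: trim_partition (family_sorted colsum_mono). Qed.

Lemma size_aT : (size (aT T lam) <= a)%N.
Proof. exact: size_trim_family. Qed.

Lemma size_bT : (size (bT T lam) <= b)%N.
Proof. exact: size_trim_family. Qed.

Lemma sum_tableau : (\sum_p nth 0 lam (T p) = sumn lam)%N.
Proof.
case: hT => [[T' TK T'K] _ _]; rewrite (sumn_nth size_lam).
by rewrite [RHS](reindex T) //; exists T' => ? _.
Qed.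

Lemma sumn_aT : sumn (aT T lam) = sumn lam.
Proof. by rewrite sumn_trim_family pair_big -sum_tableau; apply: eq_bigr => -[]. Qed.

Lemma sumn_bT : sumn (bT T lam) = sumn lam.
Proof.
rewrite sumn_trim_family exchange_big pair_big -sum_tableau.
by apply: eq_bigr => -[].
Qed.

(** The box in row T(i, j) and column c of [lam] is placed at (i, j, c); the three
tableaux used are (row T(i, j), column c), (row i, column (j, c)) and
(row j, column (i, c)). *)
Lemma kronecker_tableau_neq0 (C : numClosedFieldType) :
  kronecker C lam (aT T lam) (bT T lam) <> 0%N.
Proof.
rewrite /kronecker sumn_aT sumn_bT eqxx; apply/eqP.
set n := sumn lam.
have [[T' TK T'K] Trow Tcol] := hT.
have lt_t (x : 'I_n) : (reshape_index lam x < a * b)%N.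
  by apply: leq_trans size_lam; apply: box_row_lt.
(* The position (i, j) of the box x in the rectangle. *)
pose z x := T' (Ordinal (lt_t x)).
have Tz x : T (z x) = reshape_index lam x :> nat by rewrite T'K.
pose k1 (x : 'I_n) := reshape_offset lam x.
have card_z p : #|[set x | z x == p]| = nth 0%N lam (T p).
  rewrite -(card_row (n := n) erefl); apply: eq_card => x; rewrite !inE -Tz.
  by rewrite val_eqE (can_eq TK).
have z_inj x y : z x = z y -> k1 x = k1 y -> x = y.
  by move=> eqz eqk; apply: (box_inj (s := lam)); rewrite -?Tz ?eqz.
have down_z x p : (T p < T (z x))%N -> exists y, z y = p /\ k1 y = k1 x.
  move=> lt_p; have lt_k : (k1 x < nth 0 lam (T p))%N.
    apply: leq_trans (box_col_lt _ x) _; first by [].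
    by rewrite -Tz; apply: part_leq part_lam _ _ _; apply: ltnW.
  have [y [ry cy]] := box_ex (n := n) erefl lt_k; exists y; split=> //.
  by apply: (can_inj TK); apply: val_inj; rewrite /= Tz.
have [g2 fill2] : exists g2, filling_perm (aT T lam)
    (fun x => nat_of_ord (z x).1) (fun x => ((z x).2, k1 x)) g2.
  apply: filling_perm_ord (sumn_aT) size_aT _ _ _.
  - move=> x y e1 [e2 ek]; apply: z_inj ek.
    by rewrite [LHS]surjective_pairing e1 e2 -surjective_pairing.
  - move=> i; rewrite nth_aT -sum1_card (partition_big (fun x => (z x).2) predT) //=.
    apply: eq_bigr => j _; rewrite -card_z -sum1_card; apply: eq_bigl => x.
    by rewrite !inE [in RHS](surjective_pairing (z x)) xpair_eqE.
  move=> x i lt_i; have [|y [zy ky]] := down_z x (i, (z x).2).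
    by rewrite {2}(surjective_pairing (z x)) Tcol.
  by exists y; rewrite zy ky.
have [g3 fill3] : exists g3, filling_perm (bT T lam)
    (fun x => nat_of_ord (z x).2) (fun x => ((z x).1, k1 x)) g3.
  apply: filling_perm_ord (sumn_bT) size_bT _ _ _.
  - move=> x y e1 [e2 ek]; apply: z_inj ek.
    by rewrite [LHS]surjective_pairing e1 e2 -surjective_pairing.
  - move=> j; rewrite nth_bT -sum1_card (partition_big (fun x => (z x).1) predT) //=.
    apply: eq_bigr => i _; rewrite -card_z -sum1_card; apply: eq_bigl => x.
    by rewrite !inE [in RHS](surjective_pairing (z x)) xpair_eqE andbC.
  move=> x j lt_j; have [|y [zy ky]] := down_z x ((z x).1, j).
    by rewrite {2}(surjective_pairing (z x)) Trow.
  by exists y; rewrite zy ky.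
have fill1 : filling_perm lam (fun x : 'I_n => reshape_index lam x) k1 1%g.
  by split=> [x | x y]; rewrite !perm1.
have row_z (p : 'S_n) (x : 'I_n) : reshape_index lam (p x) = reshape_index lam x -> z (p x) = z x.
  by move=> eq_row; apply: (can_inj TK); apply: val_inj; rewrite /= !Tz.
apply: (rank_rfix_fillings C fill1 fill2 fill3).
- by apply/subsetP => p /fun_stabP stab; apply/fun_stabP => x; rewrite row_z.
- by apply/subsetP => p /fun_stabP stab; apply/fun_stabP => x; rewrite row_z.
- by apply/subsetP => p /fun_stabP stab; apply/fun_stabP => x; case: (stab x).
- by apply/subsetP => p /fun_stabP stab; apply/fun_stabP => x; case: (stab x).
- rewrite fun_stab_capM; apply/setP => p; apply/fun_stabP/fun_stabP => stab x.
    by have [/val_inj -> ->] := stab x.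
  by have [-> ->] := stab x.
- rewrite fun_stab_capM; apply/setP => p; apply/fun_stabP/fun_stabP => stab x.
    by have [/val_inj -> ->] := stab x.
  by have [-> ->] := stab x.
apply/trivgP/subsetP => p; rewrite inE => /andP[/fun_stabP st3 /fun_stabP st2].
apply/set1P/permP => x; rewrite perm1.
have [e1 ek] := st3 x; have [e2 _] := st2 x; apply: z_inj ek.
by rewrite [LHS]surjective_pairing e1 e2 -surjective_pairing.
Qed.

End Tableau.

(** * Boundedness for an additive tableau *)

Lemma finite_gap (R : realFieldType) (I : finType) (f : I -> R) :
  exists eps, [/\ 0 < eps, eps <= 1 & forall i, 0 < f i -> eps <= f i].
Proof.
exists (\big[Num.min/1]_(i | 0 < f i) f i); split.
- by apply: lt_bigmin.
- exact: bigmin_le_id.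
- by move=> i fi; apply: bigmin_le_cond.
Qed.

Section Bounded.

Variables (R : realType) (C : numClosedFieldType) (a b : nat).
Variables (T : 'I_a * 'I_b -> 'I_(a * b)) (lam : seq nat).
Hypotheses (hT : standard_tableau T) (hadd : additive_tableau R T).
Hypothesis part_lam : sorted geq lam.
Variables (lam0 mu0 nu0 : seq nat).
Hypothesis part_lam0 : sorted geq lam0.

Let N := (a + b + size mu0 + size nu0)%N.
Local Notation X := ('I_N.+1 * 'I_N.+1)%type.
Let emb (p : 'I_a * 'I_b) : X := (inord p.1, inord p.2).
(** The set P_l of the first l boxes of [T], inside a square that also has room for
the rows of [mu0] and [nu0]. *)
Definition prefix_set l : {set X} := [set emb p | p in [set p | (T p < l)%N]].

Lemma leq_aN : (a <= N.+1)%N. Proof. by rewrite /N -!addnA leqW // leq_addr. Qed.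
Lemma leq_bN : (b <= N.+1)%N.
Proof. by rewrite /N addnAC -!addnA leqW // addnC -addnA leq_addr. Qed.

Lemma emb1 p : (emb p).1 = p.1 :> nat.
Proof. by rewrite inordK // (leq_trans (ltn_ord _) leq_aN). Qed.

Lemma emb2 p : (emb p).2 = p.2 :> nat.
Proof. by rewrite inordK // (leq_trans (ltn_ord _) leq_bN). Qed.

Lemma emb_inj : injective emb.
Proof.
move=> [i j] [k l] /(congr1 (fun z : X => (nat_of_ord z.1, nat_of_ord z.2))).
by rewrite !emb1 !emb2 => -[/val_inj -> /val_inj ->].
Qed.

Lemma card_prefix_set l : (#|prefix_set l| <= l)%N.
Proof.
case: hT => [[T' TK _] _ _].
rewrite card_imset; last exact: emb_inj.
rewrite cardE -(size_map (fun p => nat_of_ord (T p))) -[X in (_ <= X)%N](size_iota 0 l).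
apply: uniq_leq_size => [|_ /mapP[p + ->]].
  by rewrite map_inj_uniq ?enum_uniq // => p q /val_inj; apply: can_inj TK _ _.
by rewrite mem_enum inE mem_iota.
Qed.

(** The weights x_i + y_j of an additive tableau, shifted to be at least 1, and
extended outside the rectangle by a value beyond all of them. *)
Lemma prefix_weights : exists (wx wy : nat -> R) (eps : R),
  [/\ 0 < eps, forall i, 0 <= wx i, forall j, 0 <= wy j,
      forall z : X, eps <= wx z.1 + wy z.2 &
      forall l (z z' : X), z \in prefix_set l -> z' \notin prefix_set l ->
        wx z.1 + wy z.2 + eps <= wx z'.1 + wy z'.2].
Proof.
case: hadd => x [y [_ _ Txy]].
have [eps [eps_gt0 eps_le1 epsP]] := finite_gap (fun pq : ('I_a * 'I_b) * ('I_a * 'I_b) =>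
  (x pq.2.1 + y pq.2.2) - (x pq.1.1 + y pq.1.2)).
(* After the shift by M the inner coordinates lie in [1, 2M], so that
   inner weights are at most 4 M; outer ones are at least 4 M + 1, and eps <= 1. *)
pose M := 1 + \sum_i `|x i| + \sum_j `|y j|.
have sx0 : 0 <= \sum_i `|x i| by apply: sumr_ge0.
have sy0 : 0 <= \sum_j `|y j| by apply: sumr_ge0.
have x_le i : `|x i| <= \sum_i `|x i|.
  by rewrite (bigD1 i) //= lerDl sumr_ge0.
have y_le j : `|y j| <= \sum_j `|y j|.
  by rewrite (bigD1 j) //= lerDl sumr_ge0.
have xM i : 1 <= x i + M /\ x i + M <= 2 * M.
  by have := x_le i; rewrite ler_norml /M => /andP[]; lra.
have yM j : 1 <= y j + M /\ y j + M <= 2 * M.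
  by have := y_le j; rewrite ler_norml /M => /andP[]; lra.
pose wx (r : nat) := if insub r is Some i then x i + M else 4 * M.
pose wy (r : nat) := if insub r is Some j then y j + M else 4 * M.
have M1 : 1 <= M by rewrite /M; lra.
have wx1 r : 1 <= wx r by rewrite /wx; case: insubP => [i _ _|_]; [case: (xM i) | lra].
have wy1 r : 1 <= wy r by rewrite /wy; case: insubP => [i _ _|_]; [case: (yM i) | lra].
have wxE (i : 'I_a) : wx i = x i + M by rewrite /wx valK.
have wyE (j : 'I_b) : wy j = y j + M by rewrite /wy valK.
exists wx, wy, eps; split=> // [i|j|z|l z z' /imsetP[p + ->] notP].
- by have := wx1 i; lra.
- by have := wy1 j; lra.
- by have := wx1 z.1; have := wy1 z.2; lra.
rewrite inE emb1 emb2 wxE wyE => lt_p.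
have [xp yp] := (xM p.1, yM p.2).
case: (ltnP z'.1 a) => [lt_a|le_a]; last first.
  rewrite {1}/wx insubN -?leqNgt //; have := wy1 z'.2; lra.
case: (ltnP z'.2 b) => [lt_b|le_b]; last first.
  rewrite {1}/wy insubN -?leqNgt //; have := wx1 z'.1; lra.
pose q := (Ordinal lt_a, Ordinal lt_b).
have z'q : z' = emb q.
  by rewrite [LHS]surjective_pairing /emb /q /= !inord_val.
have le_q : (l <= T q)%N.
  by rewrite leqNgt; apply: contra notP => lt_q; rewrite z'q imset_f // inE.
rewrite z'q emb1 emb2 wxE wyE.
have := epsP (p, q); rewrite subr_gt0 => /(_ _)/=.
have /Txy lt_pq : (T (p.1, p.2) < T (q.1, q.2))%N by rewrite -!surjective_pairing (leq_trans lt_p).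
by move=> /(_ lt_pq) /=; lra.
Qed.

(** Both sides of the weight inequality are affine in [k] with the same slope,
since the marginals of [lam] along [T] are [aT T lam] and [bT T lam]; the
number of bad columns allowed is therefore independent of [k]. *)
Lemma kronecker_bounded : exists B : nat, forall k,
  (kronecker C (addp lam0 (scalep k lam)) (addp mu0 (scalep k (aT T lam)))
             (addp nu0 (scalep k (bT T lam))) <= B)%N.
Proof.
have [wx [wy [eps [eps_gt0 wx_ge0 wy_ge0 w_ge gap]]]] := prefix_weights.
pose w (z : X) := wx z.1 + wy z.2.
pose D := \sum_(r < N.+1) wx r *+ nth 0%N mu0 r + \sum_(r < N.+1) wy r *+ nth 0%N nu0 r.
have D_ge0 : 0 <= D by apply: addr_ge0; apply: sumr_ge0 => r _; apply: mulrn_wge0.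
(* D is the weight that does not grow with k; each bad column uses up at least eps of it. *)
pose K := Num.bound (D / eps).
have le_DK : D <= eps *+ K.
  rewrite -[eps *+ K]mulr_natr mulrC -ler_pdivrMr //.
  by apply/ltW/archi_boundP; rewrite divr_ge0 // ltW.
exists #|{ffun {set X} -> 'I_K.+1}| => k; rewrite /kronecker.
set laM := addp lam0 _; set muM := addp mu0 _; set nuM := addp nu0 _.
case: ifP => // /andP[/eqP sum_mu /eqP sum_nu].
have part_aT : sorted geq (aT T lam) by case/andP: (aT_partition hT part_lam).
have part_bT : sorted geq (bT T lam) by case/andP: (bT_partition hT part_lam).
have part_laM : sorted geq laM by apply: addp_sorted.
have size_muM : (size muM <= N.+1)%N.
  apply: leq_trans (size_addp_scalep _ _ _) _; rewrite geq_max.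
  rewrite (leq_trans (size_aT _ _) leq_aN) andbT /N.
  by rewrite addnAC leqW // leq_addl.
have size_nuM : (size nuM <= N.+1)%N.
  apply: leq_trans (size_addp_scalep _ _ _) _; rewrite geq_max.
  by rewrite (leq_trans (size_bT _ _) leq_bN) andbT /N leqW // leq_addl.
apply: (rank_rfix_le C erefl sum_mu sum_nu part_laM size_muM size_nuM
  eps_gt0 w_ge card_prefix_set gap).
have sum_x : \sum_(r < N.+1) wx r *+ nth 0%N (aT T lam) r
           = \sum_p wx (p : 'I_a * 'I_b).1 *+ nth 0%N lam (T p).
  rewrite -(sum_row erefl wx (leq_trans (size_aT T lam) leq_aN)).
  rewrite (sum_row erefl wx (size_aT T lam)).
  transitivity (\sum_(i < a) \sum_(j < b) wx i *+ nth 0%N lam (T (i, j))).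
    by apply: eq_bigr => i _; rewrite (nth_aT hT part_lam) sumrMnr.
  by rewrite pair_bigA /=; apply: eq_bigr => -[].
have sum_y : \sum_(r < N.+1) wy r *+ nth 0%N (bT T lam) r
           = \sum_p wy (p : 'I_a * 'I_b).2 *+ nth 0%N lam (T p).
  rewrite -(sum_row erefl wy (leq_trans (size_bT T lam) leq_bN)).
  rewrite (sum_row erefl wy (size_bT T lam)).
  transitivity (\sum_(j < b) \sum_(i < a) wy j *+ nth 0%N lam (T (i, j))).
    by apply: eq_bigr => j _; rewrite (nth_bT hT part_lam) sumrMnr.
  by rewrite exchange_big pair_bigA /=; apply: eq_bigr => -[].
have sum_P : \sum_(c < sumn laM) weight w (prefix_set (col_len laM c))
           = \sum_p w (emb p) *+ nth 0%N laM (T p).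
  transitivity (\sum_(c < sumn laM) \sum_p w (emb p) *+ (c < nth 0 laM (T p))%N).
    apply: eq_bigr => c _; rewrite /weight big_imset /=; last by move=> ? ? _ _ /emb_inj.
    rewrite big_mkcond; apply: eq_bigr => p _; rewrite inE ltn_col_len //.
    by case: ltnP.
  rewrite exchange_big; apply: eq_bigr => p _ /=; rewrite sumrMnr; congr (_ *+ _).
  have := part_leq_sum (erefl (sumn laM)) (T p); move: (nth 0 laM (T p))%N => m le_m.
  rewrite (eq_bigr (fun c : 'I__ => if (c < m)%N then 1%N else 0%N)); last first.
    by move=> c _; case: ltnP.
  by rewrite -big_mkcond (big_ord_narrow le_m) sum1_card card_ord.
have split_k (I : finType) (f : I -> R) (u v : I -> nat) :
    \sum_i f i *+ (u i + k * v i) = \sum_i f i *+ u i + (\sum_i f i *+ v i) *+ k.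
  by rewrite -sumrMnl -big_split; apply: eq_bigr => i _; rewrite mulrnDr mulnC mulrnA.
rewrite sum_P.
under eq_bigr => r _ do rewrite nth_addp nth_scalep //.
under [X in _ + X <= _]eq_bigr => r _ do rewrite nth_addp nth_scalep //.
under [X in _ <= X + _]eq_bigr => p _ do rewrite nth_addp nth_scalep //.
rewrite !split_k sum_x sum_y.
have -> : \sum_p w (emb p) *+ nth 0%N lam (T p)
  = \sum_p wx (p : 'I_a * 'I_b).1 *+ nth 0%N lam (T p)
    + \sum_p wy (p : 'I_a * 'I_b).2 *+ nth 0%N lam (T p).
  by rewrite -big_split; apply: eq_bigr => p _; rewrite /w emb1 emb2 mulrnDl.
rewrite addrACA -mulrnDl -/D [X in _ <= X]addrAC lerD2r; apply: le_trans le_DK _.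
by rewrite lerDr; apply: sumr_ge0 => p _; rewrite mulrn_wge0 // (le_trans (ltW eps_gt0)) ?w_ge.
Qed.

End Bounded.

Local Close Scope ring_scope.

Theorem proposition7 (R : realType) (a b : nat)
    (T : 'I_a * 'I_b -> 'I_(a * b))
    (hT : standard_tableau T) (hadd : additive_tableau R T)
    (lam : seq nat) (hlam : is_partition lam) (hlen : size lam <= a * b) :
  stable R[i] lam (aT T lam) (bT T lam).
Proof.
have /andP[part_lam _] := hlam; split.
- by rewrite hlam aT_partition // bT_partition.
- exact: kronecker_tableau_neq0.
by move=> lam0 mu0 nu0 /andP[part0 _] _ _; apply: (kronecker_bounded _ hT hadd part_lam).
Qed.
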